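(* Let $\beta\in B$, let $a\in\mathbb R^d$ and let $J_\beta(a)$ be finite. The families $\mathcal G_a$ and $\mathrm{exn}(\mathcal F_\beta)$ intersect if and only if the primal solution $g_a$ for $a$ exists, in which case the intersection equals $\{g_a\}$ (functions being identified when $\mu$-a.e. equal).
   Context: Setting. $(Z,\mathcal Z)$ is a measurable space with a $\sigma$-finite measure $\mu$, and $\varphi\colon Z\to\mathbb R^d$ is $\mathcal Z$-measurable (the moment mapping). $\Gamma$ is the class of functions $\gamma\colon\mathbb R\to(-\infty,+\infty]$ that are finite and strictly convex on $(0,+\infty)$, equal to $+\infty$ for $t<0$, and satisfy $\gamma(0)=\lim_{t\downarrow0}\gamma(t)$. $B$ is the class of functions $\beta\colon Z\times\mathbb R\to(-\infty,+\infty]$ such that $\beta(\cdot,t)$ is $\mathcal Z$-measurable for each $t$ and $\beta(z,\cdot)\in\Gamma$ for each $z$. Convention: an integral whose positive and negative parts are both infinite equals $+\infty$. $\mathcal G$ is the linear space of $\mathcal Z$-measurable $g\colon Z\to\mathbb R$ with $\varphi g$ $\mu$-integrable; $\mathcal G_a=\{g\in\mathcal G\colon\int_Z\varphi g\,d\mu=a\}$; the superscript $+$ denotes the subset of nonnegative functions. $H_\beta(g)=\int_Z\beta(z,g(z))\,\mu(dz)$, $J_\beta(a)=\inf_{g\in\mathcal G_a^+}H_\beta(g)$ ($\inf\emptyset=+\infty$). When $J_\beta(a)$ is finite, the primal solution $g_a$ for $a$ is the ($\mu$-a.e. unique) minimizer of $H_\beta$ over $\mathcal G_a^+$, if it exists.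 $\beta^*(z,r)=\sup_t[rt-\beta(z,t)]$, and $(\beta^* )'(z,\cdot)$ is its derivative in $r$. $\mathrm{cn}_\varphi(\mu)=\{\int_Z\varphi g\,d\mu\colon g\in\mathcal G^+\}$. A face of a convex set $C\subseteq\mathbb R^d$ is a nonempty convex $F\subseteq C$ such that every closed line segment in $C$ with a relative interior point in $F$ lies in $F$ ($F=C$ allowed). $\mathrm{cl}$ is closure. For a face $F$ of $\mathrm{cn}_\varphi(\mu)$, $K_{F,\beta}(\vartheta)=\int_{\{\varphi\in\mathrm{cl}(F)\}}\beta^*(z,\langle\vartheta,\varphi(z)\rangle)\,\mu(dz)$; $\Theta_{F,\beta}$ is the set of $\vartheta\in\mathbb R^d$ with $K_{F,\beta}(\vartheta)<+\infty$ such that for $\mu$-a.a. $z$ with $\varphi(z)\in\mathrm{cl}(F)$ the function $r\mapsto\beta^*(z,r)$ is finite in a neighborhood of $\langle\vartheta,\varphi(z)\rangle$. For $\vartheta\in\Theta_{F,\beta}$, $f_{F,\vartheta}(z)=(\beta^* )'(z,\langle\vartheta,\varphi(z)\rangle)$ if $\varphi(z)\in\mathrm{cl}(F)$ and the derivative exists, and $f_{F,\vartheta}(z)=0$ otherwise. $\mathcal F_{F,\beta}=\{f_{F,\vartheta}\colon\vartheta\in\Theta_{F,\beta}\}$, and the extension $\mathrm{exn}(\mathcal F_\beta)$ is the union of the families $\mathcal F_{F,\beta}$ over all faces $F$ of $\mathrm{cn}_\varphi(\mu)$. *)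

(* Defs.v *)
From HB Require Import structures.
From mathcomp Require Import all_boot all_order all_algebra.
From mathcomp Require Import all_classical all_reals all_analysis.
From mathcomp Require Import measurable_realfun.
Import Order.TTheory GRing.Theory Num.Theory.
Import numFieldNormedType.Exports.

Set Implicit Arguments.
Unset Strict Implicit.
Unset Printing Implicit Defensive.

Local Open Scope classical_set_scope.
Local Open Scope ring_scope.

(** Integral with the convention that it equals +oo as soon as its positive and
    negative parts are both infinite ([integral] would return -oo there). *)
Definition pintegral d (Z : measurableType d) (R : realType)
    (mu : {measure set Z -> \bar R}) (D : set Z) (f : Z -> \bar R) : \bar R :=
  if (\int[mu]_(z in D) (f^\+ z) == +oo)%E && (\int[mu]_(z in D) (f^\- z) == +oo)%E
  then +oo%E else (\int[mu]_(z in D) f z)%E.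

Section integrands.
Variable R : realType.

Definition class_Gamma (gamma : R -> \bar R) : Prop :=
  [/\ forall t, gamma t != -oo%E,
      forall t : R, 0 < t -> gamma t \is a fin_num,
      forall s t l : R, 0 < s -> 0 < t -> s != t -> 0 < l -> l < 1 ->
        (gamma ((1 - l) * s + l * t)%R < (1 - l)%:E * gamma s + l%:E * gamma t)%E,
      forall t : R, t < 0 -> gamma t = +oo%E &
      gamma t @[t --> 0^'+] --> gamma 0].

Definition class_B d (Z : measurableType d) (beta : Z -> R -> \bar R) : Prop :=
  (forall t, measurable_fun [set: Z] (fun z => beta z t)) /\
  (forall z, class_Gamma (beta z)).

Definition conjugate (gamma : R -> \bar R) (r : R) : \bar R :=
  ereal_sup [set ((r * t)%:E - gamma t)%E | t in [set: R]].

Definition finite_near (h : R -> \bar R) (r : R) : Prop :=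
  \forall s \near r, h s \is a fin_num.

(** [fine] sends infinite values to 0, so differentiability of an
    extended-valued function at r also demands finiteness around r. *)
Definition ederivable (h : R -> \bar R) (r : R) : Prop :=
  finite_near h r /\ derivable (fine \o h) r 1.

Definition ederive (h : R -> \bar R) (r : R) : R := derive1 (fine \o h) r.

End integrands.

Section faces.
Variables (R : realType) (n : nat).

Definition inner (u v : 'rV[R]_n) : R := \sum_(i < n) u ord0 i * v ord0 i.

Definition closed_segment (x y : 'rV[R]_n) : set 'rV[R]_n :=
  [set (1 - t) *: x + t *: y | t in `[0, 1]].

(** The relative interior of [closed_segment x y], also when x = y. *)
Definition open_segment (x y : 'rV[R]_n) : set 'rV[R]_n :=
  [set (1 - t) *: x + t *: y | t in `]0, 1[].

Definition face (C F : set 'rV[R]_n) : Prop :=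
  [/\ F !=set0, @convex_set R 'rV[R]_n F, F `<=` C &
      forall x y, closed_segment x y `<=` C ->
        (open_segment x y `&` F) !=set0 -> closed_segment x y `<=` F].

End faces.

Section problem.
Context d (Z : measurableType d) (R : realType) (n : nat).
Variables (mu : {measure set Z -> \bar R}) (phi : Z -> 'rV[R]_n).
Variable beta : Z -> R -> \bar R.

Definition moment (g : Z -> R) : 'rV[R]_n :=
  \row_(i < n) \int[mu]_z (phi z ord0 i * g z).

Definition class_G : set (Z -> R) :=
  [set g | measurable_fun [set: Z] g /\
     forall i, mu.-integrable [set: Z] (fun z => (phi z ord0 i * g z)%:E)].

Definition class_Gpos : set (Z -> R) :=
  class_G `&` [set g | forall z, 0 <= g z].

Definition class_Ga (a : 'rV[R]_n) : set (Z -> R) :=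
  class_G `&` [set g | moment g = a].

Definition class_Gapos (a : 'rV[R]_n) : set (Z -> R) :=
  class_Ga a `&` [set g | forall z, 0 <= g z].

Definition H_ (g : Z -> R) : \bar R :=
  pintegral mu [set: Z] (fun z => beta z (g z)).

Definition J_ (a : 'rV[R]_n) : \bar R := ereal_inf (H_ @` class_Gapos a).

Definition primal_solution (a : 'rV[R]_n) (g : Z -> R) : Prop :=
  class_Gapos a g /\ forall h, class_Gapos a h -> (H_ g <= H_ h)%E.

Definition cn : set 'rV[R]_n := moment @` class_Gpos.

Definition K_ (F : set 'rV[R]_n) (theta : 'rV[R]_n) : \bar R :=
  pintegral mu (phi @^-1` closure F)
    (fun z => conjugate (beta z) (inner theta (phi z))).

Definition Theta (F : set 'rV[R]_n) : set 'rV[R]_n :=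
  [set theta | (K_ F theta < +oo)%E /\
     {ae mu, forall z, closure F (phi z) ->
        finite_near (conjugate (beta z)) (inner theta (phi z))}].

Definition f_ (F : set 'rV[R]_n) (theta : 'rV[R]_n) (z : Z) : R :=
  let r := inner theta (phi z) in
  if `[< closure F (phi z) /\ ederivable (conjugate (beta z)) r >]
  then ederive (conjugate (beta z)) r else 0.

Definition family_F (F : set 'rV[R]_n) : set (Z -> R) := f_ F @` Theta F.

Definition exn : set (Z -> R) := \bigcup_(F in face cn) family_F F.

(** All functions a.e. equal to a member of A: sets of functions identified up
    to a.e. equality are represented by the unions of their classes. *)
Definition mod_ae (A : set (Z -> R)) : set (Z -> R) :=
  [set g | exists2 f, A f & g = f %[ae mu]].

End problem.

(* Main.v *)
(** Minimizers satisfy a pointwise optimality condition.  If [g] has moment [a]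
    and equals [f_{F,theta}] a.e., then [r z = <theta, phi z>] is a subgradient
    of [beta z] at [g z] on [phi in cl F]; every competitor in [G_a^+] vanishes
    off that set because [a] lies in the face [F], so integrating
    [beta z (h z) >= beta z (g z) + r z * (h z - g z)] shows that [g] is optimal.
    Strict convexity gives uniqueness.

    Conversely let [g] be optimal and let [F] be the smallest face of the cone
    [cn] containing [a].  The convex cone generated by the pairs
    (moment [h] - [a], integral of [w] - H [g]), where [w] is an integrable
    majorant of [beta z (h z)], does not contain (0, -1), so some linear
    functional [(A, tau)] is nonnegative on it without vanishing on it.
    Changing [g] to a constant on small sets turns this into an inequality that
    holds for a.e. [z]; it rules out [tau = 0], since [a] is in the relative
    interior of [F], and for [tau > 0] it says that [- <A, phi z> / tau] is a
    subgradient of [beta z] at [g z].  By strict convexity such a slope is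
    interior to the domain of the conjugate, whose derivative there is [g z]. *)

Require Import Defs.
From HB Require Import structures.
From mathcomp Require Import all_boot all_order all_algebra.
From mathcomp Require Import all_classical all_reals all_analysis.
From mathcomp Require Import measurable_realfun.
From mathcomp Require Import ring lra.
Import Order.TTheory GRing.Theory Num.Theory.
Import numFieldNormedType.Exports.

Set Implicit Arguments.
Unset Strict Implicit.
Unset Printing Implicit Defensive.

Local Open Scope classical_set_scope.
Local Open Scope ring_scope.

(** * Separation of convex cones *)

Section convex_cones.
Variables (R : realType) (n : nat).
Implicit Types (C : set 'rV[R]_n) (x y u : 'rV[R]_n).

Definition convex_cone C :=
  [/\ C 0, forall x y, C x -> C y -> C (x + y) &
      forall (t : R) x, 0 <= t -> C x -> C (t *: x)].

Lemma convex_cone_sum C (I : finType) (c : I -> R) (v : I -> 'rV[R]_n) :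
  convex_cone C -> (forall i, 0 <= c i) -> (forall i, C (v i)) ->
  C (\sum_i c i *: v i).
Proof.
move=> [C0 CD CZ] c0 Cv; elim/big_ind : _ => // i _; exact: CZ.
Qed.

(** Take rows from [C] of the largest possible rank: a vector of [C] outside their row space could
    be appended and would increase the rank. *)
Lemma convex_cone_spanning C : convex_cone C ->
  exists k (B : 'M[R]_(k, n)),
    (forall i, C (row i B)) /\ (forall x, C x -> (x <= B)%MS).
Proof.
move=> [C0 CD CZ].
pose P r := `[< exists k (B : 'M[R]_(k, n)),
  (forall i, C (row i B)) /\ \rank B = r >].
have exP : exists r, P r.
  by exists 0%N; apply/asboolP; exists 0%N, 0; split; [case|rewrite mxrank0].
have Pn r : P r -> (r <= n)%N.
  by move=> /asboolP[k [B [_ <-]]]; exact: rank_leq_col.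
case: (ex_maxnP exP Pn) => r /asboolP[k [B [CB rB]]] rmax.
exists k, B; split=> // x Cx; apply: contrapT => /negP xB.
have : P (\rank (col_mx B x)).
  apply/asboolP; exists (k + 1)%N, (col_mx B x); split=> // i.
  rewrite -[i]splitK; case: (fintype.split i) => j /=.
    by rewrite rowKu.
  rewrite rowKd; suff -> : row j x = x by [].
  by apply/rowP => l; rewrite mxE ord1.
move=> /rmax; rewrite leqNgt -rB => /negP; apply.
rewrite ltn_neqAle; apply/andP; split; last first.
  by apply: mxrankS; rewrite -addsmxE addsmxSl.
apply: contra xB => /eqP rE.
have : (B == col_mx B x)%MS.
  rewrite -(mxrank_leqif_eq _) ?rE //.
  by rewrite -addsmxE addsmxSl.
move=> /andP[_]; apply: submx_trans.
by rewrite -addsmxE addsmxSr.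
Qed.

(* [u] lies in the relative interior of [C] and [P] projects onto the span of
   [C]. *)
Lemma convex_cone_core C : convex_cone C ->
  exists u (P : 'M[R]_n), [/\ C u, forall x, C x -> x *m P = x &
    forall x, exists2 t : R, 0 <= t & C (t *: u - x *m P)].
Proof.
move=> coneC; have [k [B [CB spanB]]] := convex_cone_spanning coneC.
exists (\sum_i row i B), (pinvmx B *m B); split.
- have := @convex_cone_sum C _ (fun=> 1) (fun i => row i B) coneC (fun=> ler01) CB.
  by under eq_bigr do rewrite scale1r.
- by move=> x /spanB xB; rewrite mulmxA mulmxKpV.
- move=> x; set y := x *m pinvmx B.
  (* This multiple dominates every coordinate [y ord0 i], so the difference is a combination of rows
     of [B] with nonnegative coefficients. *)
  exists (\sum_i `|y ord0 i|); first exact: sumr_ge0.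
  have -> : (\sum_i `|y ord0 i|) *: (\sum_i row i B) - x *m (pinvmx B *m B) =
      \sum_i (\sum_j `|y ord0 j| - y ord0 i) *: row i B.
    under [RHS]eq_bigr do rewrite scalerBl.
    by rewrite sumrB -scaler_sumr mulmxA -/y [y *m B]mulmx_sum_row.
  apply: convex_cone_sum => // i.
  rewrite subr_ge0 (le_trans (ler_norm _))// (bigD1 i)//= lerDl.
  exact: sumr_ge0.
Qed.

Lemma innerDr x y z : inner x (y + z) = inner x y + inner x z.
Proof.
by rewrite /inner -big_split /=; apply: eq_bigr => i _; rewrite mxE mulrDr.
Qed.

Lemma innerZr (t : R) x y : inner x (t *: y) = t * inner x y.
Proof.
by rewrite /inner mulr_sumr; apply: eq_bigr => i _; rewrite mxE mulrCA.
Qed.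

Lemma innerNr x y : inner x (- y) = - inner x y.
Proof. by rewrite -scaleN1r innerZr mulN1r. Qed.

Lemma innerBr x y z : inner x (y - z) = inner x y - inner x z.
Proof. by rewrite innerDr innerNr. Qed.

Lemma innerZl (t : R) x y : inner (t *: x) y = t * inner x y.
Proof.
by rewrite /inner mulr_sumr; apply: eq_bigr => i _; rewrite mxE mulrA.
Qed.

Definition sublinear (p : 'rV[R]_n -> R) :=
  (forall x y, p (x + y) <= p x + p y) /\
  (forall (t : R) x, 0 <= t -> p (t *: x) = t * p x).

Lemma sublinearW p : (forall x y, p (x + y) <= p x + p y) ->
  (forall (t : R) x, 0 <= t -> p (t *: x) <= t * p x) -> sublinear p.
Proof.
move=> pD pZ; split=> // t x; rewrite le_eqVlt => /predU1P[<-|t0].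
  apply/eqP; rewrite eq_le; apply/andP; split; first exact: pZ.
  rewrite mul0r scale0r; have := pD 0 0; rewrite addr0; lra.
apply/eqP; rewrite eq_le; apply/andP; split; first exact: pZ (ltW t0).
have := @pZ t^-1 (t *: x); rewrite scalerA mulVf ?gt_eqF// scale1r.
by rewrite invr_ge0 (ltW t0) => /(_ isT); rewrite mulrC ler_pdivlMr// mulrC.
Qed.

Lemma sublinear0 p : sublinear p -> p 0 = 0.
Proof. by move=> [_ pZ]; rewrite -(scale0r 0) pZ// mul0r. Qed.

Lemma sublinearN_ge p x : sublinear p -> - p (- x) <= p x.
Proof.
move=> sp; rewrite lerNl -subr_ge0 opprK.
by rewrite (le_trans _ (sp.1 (-x) x))// addNr sublinear0.
Qed.

(** One step of the Hahn-Banach argument. The function [q x = inf_(t >= 0) (p (x + t e) - t p e)] is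
    again sublinear, and [t = 1] at [- e] gives [q (- e) <= - p e <= - q e], so [q] is linear on the
    line through [e]. *)
Lemma sublinear_lower p e : sublinear p -> exists q,
  [/\ sublinear q, forall x, q x <= p x & q (- e) <= - q e].
Proof.
move=> sp; have [pD pZ] := sp.
pose A x := [set p (x + t *: e) - t * p e | t in [set t : R | 0 <= t]].
have Albound x : lbound (A x) (- p (- x)).
  move=> _ [t /= t0 <-]; rewrite -pZ//.
  suff : p (t *: e) <= p (x + t *: e) + p (- x) by lra.
  by apply: le_trans (pD _ _); rewrite addrAC subrr add0r.
have Anonempty x : A x !=set0 by exists (p (x + 0 *: e) - 0 * p e), 0 => /=.
have hiA x : has_inf (A x) by split=> //; exists (- p (- x)).
have infA x (t : R) : 0 <= t -> inf (A x) <= p (x + t *: e) - t * p e.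
  by move=> t0; apply: ge_inf; [exists (- p (- x))|exists t].
have qle x : inf (A x) <= p x.
  by rewrite (le_trans (infA x 0 _))// scale0r addr0 mul0r subr0.
have qD x y : inf (A (x + y)) <= inf (A x) + inf (A y).
  rewrite -lerBlDr; apply: lb_le_inf => // _ [t /= t0 <-].
  rewrite lerBlDl -lerBlDr; apply: lb_le_inf => // _ [s /= s0 <-].
  rewrite lerBlDr (le_trans (infA _ (t + s) _)) ?addr_ge0//.
  have h := pD (x + t *: e) (y + s *: e).
  by rewrite scalerDl addrACA mulrDl; lra.
have qZ (t : R) x : 0 <= t -> inf (A (t *: x)) <= t * inf (A x).
  rewrite le_eqVlt => /predU1P[<-|t0].
    by rewrite mul0r scale0r (le_trans (qle 0))// sublinear0.
  rewrite mulrC -ler_pdivrMr//; apply: lb_le_inf => // _ [s /= s0 <-].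
  rewrite ler_pdivrMr// (le_trans (infA _ (t * s) _))//; first by rewrite mulr_ge0// ltW.
  rewrite -scalerA -scalerDr pZ ?(ltW t0)//.
  lra.
exists (fun x => inf (A x)); split=> //.
- exact: sublinearW.
- apply: (le_trans (infA (- e) 1 ler01)).
  by rewrite scale1r addNr sublinear0// mul1r sub0r lerN2.
Qed.

(** Later steps do not spoil earlier ones: a sublinear [r <= q] still satisfies
    [r (- e) <= q (- e) <= - q e <= - r e]. *)
Lemma sublinear_lower_seq p (s : seq 'rV[R]_n) : sublinear p -> exists q,
  [/\ sublinear q, forall x, q x <= p x & forall e, e \in s -> q (- e) <= - q e].
Proof.
elim: s p => [|e s IH] p sp; first by exists p; split.
have [q [sq qp qe]] := sublinear_lower e sp.
have [r [sr rq rs]] := IH q sq.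
exists r; split=> // [x|f]; first exact: le_trans (rq x) (qp x).
rewrite inE => /predU1P[->|]; last exact: rs.
apply: (le_trans (rq _)); apply: (le_trans qe).
by rewrite lerN2.
Qed.

(** For a minorant [q] that is linear along each basis vector, expanding [x] in coordinates gives
    [q x <= inner th x]; the same bound at [- x] gives the reverse inequality. *)
Lemma finite_dim_hahn_banach p : sublinear p ->
  exists th, forall x, inner th x <= p x.
Proof.
move=> sp; pose s := [seq delta_mx ord0 i : 'rV[R]_n | i <- enum 'I_n].
have [q [[qD qZ] qp qs]] := sublinear_lower_seq s sp.
have sq : sublinear q by split.
pose th : 'rV[R]_n := \row_i q (delta_mx ord0 i).
have qsum (v : 'I_n -> 'rV[R]_n) : q (\sum_i v i) <= \sum_i q (v i).
  elim/big_ind2 : _ => //; first by rewrite sublinear0.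
  by move=> x1 x2 y1 y2 h1 h2; apply: le_trans (qD _ _) _; exact: lerD.
have qle x : q x <= inner th x.
  rewrite {1}[x]row_sum_delta (le_trans (qsum _))//; apply: ler_sum => i _.
  rewrite !mxE; have [x0|x0] := leP 0 (x ord0 i).
    by rewrite qZ// mulrC.
  have -> : x ord0 i *: delta_mx ord0 i =
      (- x ord0 i) *: (- delta_mx ord0 i : 'rV[R]_n) by rewrite scalerN scaleNr opprK.
  have Nx0 : 0 <= - x ord0 i by rewrite oppr_ge0 ltW.
  rewrite qZ// -[leRHS]mulrNN [leRHS]mulrC; apply: ler_wpM2l => //.
  by rewrite qs//; apply: map_f; rewrite mem_enum.
exists th => x; apply: le_trans (qp x).
rewrite -lerN2 -innerNr; apply: le_trans (qle (- x)).
by rewrite lerNl sublinearN_ge.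
Qed.

(** With [u] in the relative interior of [C], the functional is dominated by the gauge sending [x]
    to the infimum of the [t] such that [t u - x P] lies in [C]. This gauge is at most 0 on [- C]
    and at most -1 at [- u], which gives the sign on [C] and positivity at [u]. *)
Lemma convex_cone_separation C (v : 'rV[R]_n) : convex_cone C ->
  C v -> ~ C (- v) ->
  exists th, (forall x, C x -> 0 <= inner th x) /\
    exists2 u, C u & 0 < inner th u.
Proof.
move=> coneC Cv CNv; have [C0 CD CZ] := coneC.
have [u [P [Cu PC core]]] := convex_cone_core coneC.
(* Some [t u - v] lies in [C]; adding [t] times [- u] would put [- v] in [C]. *)
have CNu : ~ C (- u).
  move=> CNu; apply: CNv; have [t t0] := core v; rewrite (PC v)// => tv.
  by rewrite -[- v](addKr (t *: u)) -scalerN addrC; apply: CD tv _; exact: CZ.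
pose A x := [set t : R | C (t *: u - x *m P)].
(* The gauge is bounded below: if [t + s < 0], adding the two memberships puts a negative multiple
   of [u] in [C]. *)
have Alb x (t s : R) : C (s *: u + x *m P) -> A x t -> - s <= t.
  rewrite /A /= => sC tC; rewrite leNgt; apply/negP => ts.
  have : C ((t + s) *: u).
    by rewrite scalerDl -[t *: u](subrK (x *m P)) -addrA [x *m P + _]addrC; exact: CD.
  have st0 : 0 < - (t + s) by lra.
  move=> /(CZ (- (t + s))^-1 _ (ltW _)); rewrite invr_gt0 => /(_ st0).
  rewrite scalerA -[X in _ * X]opprK mulrN mulVf ?gt_eqF// scaleN1r.
  exact: CNu.
have coreN x : exists s : R, C (s *: u + x *m P).
  by have [s _] := core (- x); rewrite mulNmx opprK; exists s.
have Ahi x : has_inf (A x).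
  split; first by have [t _ tC] := core x; exists t.
  by have [s sC] := coreN x; exists (- s) => t; exact: Alb.
have Ainf x t : A x t -> inf (A x) <= t.
  by move=> tA; apply: ge_inf => //; exact: (Ahi x).2.
have sp : sublinear (fun x => inf (A x)).
  have qZ (t : R) x : 0 <= t -> inf (A (t *: x)) <= t * inf (A x).
    rewrite le_eqVlt => /predU1P[<-|t0].
      by rewrite mul0r scale0r; apply: Ainf; rewrite /A/= mul0mx subr0 scale0r.
    rewrite mulrC -ler_pdivrMr//; apply: lb_le_inf; first exact: (Ahi x).1.
    move=> s sA; rewrite ler_pdivrMr//; apply: Ainf; rewrite /A/=.
    by rewrite mulrC -scalerA -scalemxAl -scalerBr; apply: CZ => //; exact: ltW.
  have qD x y : inf (A (x + y)) <= inf (A x) + inf (A y).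
    rewrite -lerBlDr; apply: lb_le_inf; first exact: (Ahi _).1.
    move=> t tA; rewrite lerBlDl -lerBlDr.
    apply: lb_le_inf; first exact: (Ahi _).1.
    move=> s sA; rewrite lerBlDr; apply: Ainf; rewrite /A/=.
    rewrite [s + t]addrC scalerDl mulmxDl opprD addrACA; exact: CD.
  exact: sublinearW.
have [th thp] := finite_dim_hahn_banach sp.
exists th; split.
  move=> x Cx; rewrite -oppr_le0 -innerNr (le_trans (thp _))//.
  by apply: Ainf; rewrite /A/= scale0r mulNmx opprK add0r PC.
exists u => //; rewrite -oppr_lt0 -innerNr; apply: (@le_lt_trans _ _ (- 1)).
  rewrite (le_trans (thp _))//; apply: Ainf.
  by rewrite /A/= mulNmx PC// scaleN1r opprK addNr.
by rewrite oppr_lt0.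
Qed.

End convex_cones.

(** * Strictly convex integrands and their conjugates *)

Section strictly_convex_integrand.
Variables (R : realType) (gamma : R -> \bar R).
Hypothesis Ggamma : class_Gamma gamma.

Let k t := fine (gamma t).

Lemma Gamma_fin t : 0 < t -> gamma t = (k t)%:E.
Proof. by case: Ggamma => _ gfin _ _ _ t0; rewrite fineK// gfin. Qed.

Lemma Gamma_neg t : t < 0 -> gamma t = +oo%E.
Proof. by case: Ggamma => _ _ _ + _; exact. Qed.

Lemma Gamma_pinfty t : gamma t \isn't a fin_num -> gamma t = +oo%E.
Proof.
rewrite fin_numE; have -> /= : gamma t != -oo%E by case: Ggamma.
by move=> /negPn/eqP.
Qed.

Lemma Gamma_dom t : gamma t \is a fin_num -> 0 <= t.
Proof. by apply: contraTT; rewrite -ltNge => /Gamma_neg ->. Qed.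

Lemma Gamma_cvg0 : gamma 0 \is a fin_num -> k t @[t --> 0^'+] --> k 0.
Proof. by case: Ggamma => _ _ _ _ glim g0; apply: fine_cvg; rewrite fineK. Qed.

Lemma Gamma_chord_gt0 a b c : 0 < a -> a < b -> b < c ->
  (c - a) * k b < (c - b) * k a + (b - a) * k c.
Proof.
move=> a0 ab bc; have ac := lt_trans ab bc; have c0 := lt_trans a0 ac.
have b0 := lt_trans a0 ab.
have ca0 : 0 < c - a by rewrite subr_gt0.
case: Ggamma => _ _ /(_ a c ((b - a) / (c - a)) a0 c0) + _ _.
rewrite lt_eqF// divr_gt0 ?subr_gt0// ltr_pdivrMr// mul1r ltrD2r bc.
move=> /(_ isT isT isT).
have -> : (1 - (b - a) / (c - a)) * a + (b - a) / (c - a) * c = b.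
  by field; rewrite gt_eqF.
rewrite !Gamma_fin// -!EFinM -EFinD lte_fin -(ltr_pM2l ca0) => /lt_le_trans; apply.
rewrite le_eqVlt; apply/orP; left; apply/eqP; field.
by rewrite gt_eqF.
Qed.

Let chord0_weak b c : gamma 0 \is a fin_num -> 0 < b -> b < c ->
  c * k b <= (c - b) * k 0 + b * k c.
Proof.
move=> g0 b0 bc.
have cl : (c - e) * k b @[e --> 0^'+] --> (c - 0) * k b.
  apply: cvgMl; apply: cvgB; first exact: cvg_cst.
  exact: cvg_at_right_filter cvg_id.
have cr : (c - b) * k e + (b - e) * k c @[e --> 0^'+] -->
    (c - b) * k 0 + (b - 0) * k c.
  apply: cvgD; first by apply: cvgMr; exact: Gamma_cvg0.
  apply: cvgMl; apply: cvgB; first exact: cvg_cst.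
  exact: cvg_at_right_filter cvg_id.
rewrite -[X in X * k b]subr0 -[X in _ + X * k c]subr0.
apply: ler_cvg_to cl cr _.
near=> e; apply/ltW/Gamma_chord_gt0 => //.
Unshelve. all: by end_near. Qed.

(** At [a = 0] the passage to the limit leaves only a weak inequality. Strictness is recovered by
    combining the weak chord inequality at [b / 2] with the strict one for [b / 2 < b < c]. *)
Lemma Gamma_chord a b c : gamma a \is a fin_num -> a < b -> b < c ->
  (c - a) * k b < (c - b) * k a + (b - a) * k c.
Proof.
move=> ga ab bc; have := Gamma_dom ga; rewrite le_eqVlt => /predU1P[a0|a0]; last first.
  exact: Gamma_chord_gt0.
subst a; rewrite !subr0.
have b20 : 0 < b / 2 by rewrite divr_gt0.
have b2b : b / 2 < b by lra.
have c0 : 0 < c by exact: lt_trans bc.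
have h1 := Gamma_chord_gt0 b20 b2b bc.
have h2 := chord0_weak ga b20 (lt_trans b2b bc).
have cb0 : 0 < c - b by lra.
have ca0 : 0 < c - b / 2 by lra.
rewrite -(ltr_pM2l ca0).
have h3 := ler_wpM2l (ltW cb0) h2.
have : c * ((c - b / 2) * k b) < c * ((c - b) * k (b / 2) + (b - b / 2) * k c).
  by rewrite ltr_pM2l.
lra.
Qed.

(** The slopes of the chords over [[t / 2, t]] and [[t, t + 1]] control the increments of [k] on
    both sides of [t], which yields a Lipschitz bound near [t]. *)
Lemma Gamma_continuous t : 0 < t -> {for t, continuous k}.
Proof.
move=> t0.
have t20 : 0 < t / 2 by rewrite divr_gt0.
have t2t : t / 2 < t by lra.
have tt1 : t < t + 1 by lra.
have ft s : 0 < s -> gamma s \is a fin_num by move=> s0; rewrite Gamma_fin.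
pose L1 := (k t - k (t / 2)) / (t / 2).
pose L2 := k (t + 1) - k t.
have E1 : k (t / 2) = k t - L1 * (t / 2) by rewrite /L1; field; rewrite gt_eqF.
have E2 : k (t + 1) = k t + L2 by rewrite /L2; ring.
have L10 : 0 <= `|L1| by []. have L20 : 0 <= `|L2| by [].
have lip s : `|t - s| < Num.min (t / 2) 1 -> `|k t - k s| <= (`|L1| + `|L2|) * `|t - s|.
  rewrite lt_min => /andP[]; have [st s1 s2|st|->] := ltgtP s t; last 2 first.
  - rewrite ltr0_norm ?subr_lt0// => s1 s2.
    have h1 : L1 * (s - t) <= k s - k t.
      have := Gamma_chord (ft _ t20) t2t st; rewrite E1 => h.
      by rewrite -(ler_pM2l t20); lra.
    have h2 : k s - k t <= L2 * (s - t).
      have st1 : s < t + 1 by lra.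
      have := Gamma_chord (ft _ t0) st st1; rewrite E2; lra.
    have h3 : L2 * (s - t) <= `|L2| * (s - t) by rewrite ler_wpM2r ?ler_norm//; lra.
    have h4 : - `|L1| * (s - t) <= L1 * (s - t).
      by rewrite ler_wpM2r//; [lra|rewrite lerNl -normrN ler_norm].
    have h5 : 0 <= `|L1| * (s - t) by rewrite mulr_ge0//; lra.
    have h6 : 0 <= `|L2| * (s - t) by rewrite mulr_ge0//; lra.
    by rewrite ler_norml; apply/andP; split; lra.
  - by move=> _ _; rewrite !subrr !normr0 mulr0.
  rewrite gtr0_norm ?subr_gt0// in s1 s2 *.
  have s0 : 0 < s by lra.
  have h1 : k s - k t <= - L1 * (t - s).
    have t2s : t / 2 < s by lra.
    have := Gamma_chord (ft _ t20) t2s st; rewrite E1 => h.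
    by rewrite -(ler_pM2l t20); lra.
  have h2 : - L2 * (t - s) <= k s - k t.
    have := Gamma_chord (ft _ s0) st tt1; rewrite E2; lra.
  have h3 : L2 * (t - s) <= `|L2| * (t - s) by rewrite ler_wpM2r ?ler_norm//; lra.
  have h4 : - `|L1| * (t - s) <= L1 * (t - s).
    by rewrite ler_wpM2r//; [lra|rewrite lerNl -normrN ler_norm].
  have h5 : 0 <= `|L1| * (t - s) by rewrite mulr_ge0//; lra.
  have h6 : 0 <= `|L2| * (t - s) by rewrite mulr_ge0//; lra.
  by rewrite ler_norml; apply/andP; split; lra.
apply/cvgrPdist_le => /= e e0.
have L0 : 0 < `|L1| + `|L2| + 1 by lra.
have m0 : 0 < Num.min (Num.min (t / 2) 1) (e / (`|L1| + `|L2| + 1)).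
  by rewrite !lt_min t20 ltr01 divr_gt0.
near=> s.
have : `|t - s| < Num.min (Num.min (t / 2) 1) (e / (`|L1| + `|L2| + 1)).
  by near: s; exact: (@cvgr_dist_lt _ _ _ (nbhs t) _ id t cvg_id _ m0).
rewrite lt_min => /andP[/lip h1]; rewrite ltr_pdivlMr// => h2.
have : 0 <= `|t - s| by []. lra.
Unshelve. all: by end_near. Qed.

(** This form covers the endpoint 0 as well, so later approximations of an argument, by rationals or
    by step functions, are taken from above. *)
Lemma Gamma_right_continuous t : 0 <= t -> gamma s @[s --> t^'+] --> gamma t.
Proof.
rewrite le_eqVlt => /predU1P[<-|t0]; first by case: Ggamma.
rewrite Gamma_fin//.
apply: (cvg_trans _ (_ : (k s)%:E @[s --> t^'+] --> (k t)%:E)).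
  apply: near_eq_cvg; near=> s; rewrite Gamma_fin//.
  by apply: lt_trans t0 _; near: s; exact: nbhs_right_gt.
apply: cvg_EFin; first exact: nearW.
apply: cvg_at_right_filter; exact: Gamma_continuous.
Unshelve. all: by end_near. Qed.

(** Convexity of the epigraph: real upper bounds replace the values of [gamma], so no product of a
    zero weight with an infinite value occurs. *)
Lemma Gamma_convex s t x y l : 0 <= l -> l <= 1 ->
  (gamma s <= x%:E)%E -> (gamma t <= y%:E)%E ->
  (gamma ((1 - l) * s + l * t) <= ((1 - l) * x + l * y)%:E)%E.
Proof.
have gN u : gamma u != -oo%E by case: Ggamma.
have fin u v : (gamma u <= v%:E)%E -> gamma u = (k u)%:E /\ k u <= v.
  have := gN u; rewrite /k; case: (gamma u) => //= r _; by rewrite lee_fin.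
have main u v a b m : 0 < m -> m < 1 -> u < v -> (gamma u <= a%:E)%E ->
    (gamma v <= b%:E)%E -> (gamma ((1 - m) * u + m * v) <= ((1 - m) * a + m * b)%:E)%E.
  move=> m0 m1 uv /fin[gu ua] /fin[gv vb].
  have fu : gamma u \is a fin_num by rewrite gu.
  have u0 := Gamma_dom fu.
  have mv : 0 < m * v by rewrite mulr_gt0//; lra.
  have mu : 0 <= (1 - m) * u by rewrite mulr_ge0//; lra.
  have d0 : 0 < m * (v - u) by rewrite mulr_gt0//; lra.
  have d1 : 0 < (1 - m) * (v - u) by rewrite mulr_gt0//; lra.
  have vu : 0 < v - u by lra.
  have um : u < (1 - m) * u + m * v by lra.
  have mmv : (1 - m) * u + m * v < v by lra.
  have h := Gamma_chord fu um mmv.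
  rewrite Gamma_fin ?lee_fin; last by lra.
  have h1 : (1 - m) * k u <= (1 - m) * a by rewrite ler_wpM2l//; lra.
  have h2 : m * k v <= m * b by rewrite ler_wpM2l//; lra.
  suff : k ((1 - m) * u + m * v) <= (1 - m) * k u + m * k v by lra.
  by rewrite -(ler_pM2l vu); lra.
rewrite le_eqVlt => /predU1P[<- _|l0].
  by rewrite subr0 !mul0r !mul1r !addr0.
rewrite le_eqVlt => /predU1P[->|l1].
  by rewrite subrr !mul0r !mul1r !add0r.
move=> gs gt; have [st|ts|st] := ltgtP s t.
- exact: main.
- have -> : (1 - l) * s + l * t = (1 - (1 - l)) * t + (1 - l) * s by ring.
  have -> : (1 - l) * x + l * y = (1 - (1 - l)) * y + (1 - l) * x by ring.
  by apply: main => //; lra.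
- subst t; rewrite -mulrDl subrK mul1r.
  have [gE kx] := fin _ _ gs; have [_ ky] := fin _ _ gt.
  rewrite gE lee_fin.
  have h1 : (1 - l) * k s <= (1 - l) * x by rewrite ler_wpM2l//; lra.
  have h2 : l * k s <= l * y by rewrite ler_wpM2l//; lra.
  lra.
Qed.

Lemma Gamma_midpoint s t : gamma s \is a fin_num -> gamma t \is a fin_num ->
  s != t -> k ((s + t) / 2) < (k s + k t) / 2.
Proof.
wlog st : s t / s < t.
  move=> W gs gt; rewrite neq_lt => /orP[|] h; first by apply: W => //; rewrite lt_eqF.
  by rewrite addrC [k s + _]addrC; apply: W => //; rewrite lt_eqF.
move=> gs gt _; have ts : 0 < t - s by lra.
have sm : s < (s + t) / 2 by lra.
have mt : (s + t) / 2 < t by lra.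
have h := Gamma_chord gs sm mt.
by rewrite -(ltr_pM2l ts); lra.
Qed.

End strictly_convex_integrand.

Lemma fin_num_between (R : realType) (x : \bar R) (a b : R) :
  (a%:E <= x <= b%:E)%E -> x \is a fin_num.
Proof. by case: x => [x||] //; rewrite leye_eq andbF || rewrite leeNy_eq. Qed.

(** * Subgradients and differentiability of the conjugate *)

Section conjugate_derivative.
Variables (R : realType) (gamma : R -> \bar R).
Hypothesis Ggamma : class_Gamma gamma.

Let k t := fine (gamma t).

(** The slope is the first argument, the point the second. Equivalently, [gamma t0] is finite and
    [t0] attains the supremum that defines [conjugate gamma r]. *)
Definition subgradient (r t0 : R) : Prop :=
  gamma t0 \is a fin_num /\
  forall t, (gamma t0 + (r * (t - t0))%:E <= gamma t)%E.

Lemma subgradientP (r t0 : R) : gamma t0 \is a fin_num ->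
  (forall t, gamma t \is a fin_num -> k t0 + r * (t - t0) <= k t) ->
  subgradient r t0.
Proof.
move=> g0 h; split=> // t; have [gt|] := boolP (gamma t \is a fin_num).
  by rewrite -(fineK g0) -(fineK gt) lee_fin h.
by move=> /(Gamma_pinfty Ggamma) ->; rewrite leey.
Qed.

Lemma subgradient_fine (r t0 t : R) : subgradient r t0 ->
  gamma t \is a fin_num -> k t0 + r * (t - t0) <= k t.
Proof. by move=> [g0 /(_ t)] + gt; rewrite -(fineK g0) -(fineK gt) lee_fin. Qed.

(** The chord from [t0] to [t0 + e] has slope strictly above [r], by the strict chord inequality at
    the midpoint together with the subgradient inequality there. Chord slopes from [t0] increase, so
    the surplus [c] persists beyond [t0 + e]. *)
Lemma subgradient_right (r t0 e : R) : subgradient r t0 -> 0 < e ->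
  exists2 c, 0 < c & forall t, t0 + e <= t -> k t0 + (r + c) * (t - t0) <= k t.
Proof.
move=> sg e0; have g0 := sg.1; have t00 := Gamma_dom Ggamma g0.
pose b := t0 + e; have b0 : t0 < b by rewrite /b; lra.
have gb : gamma b \is a fin_num by rewrite (Gamma_fin Ggamma)//; lra.
have m1 : t0 < t0 + e / 2 by lra.
have m2 : t0 + e / 2 < b by rewrite /b; lra.
have gm : gamma (t0 + e / 2) \is a fin_num by rewrite (Gamma_fin Ggamma)//; lra.
have h1 := Gamma_chord Ggamma g0 m1 m2.
have h2 := subgradient_fine sg gm.
have e20 : 0 < e / 2 by lra.
have h3 : e * (k t0 + r * (e / 2)) <= e * k (t0 + e / 2).
  by rewrite ler_pM2l//; lra.
have kb : r * e < k b - k t0.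
  rewrite -(ltr_pM2l e20); rewrite -/b in h1.
  have -> : e / 2 * (k b - k t0) = (b - (t0 + e/2)) * k t0 + (t0 + e / 2 - t0) * k b - e * k t0.
    by rewrite /b; field.
  have : (b - t0) * k (t0 + e / 2) = e * k (t0 + e / 2) by rewrite /b; ring.
  rewrite /k in h1 h3 *; lra.
exists ((k b - k t0) / e - r).
  by rewrite subr_gt0 ltr_pdivlMr.
move=> t; have -> : r + ((k b - k t0) / e - r) = (k b - k t0) / e by ring.
rewrite -/b le_eqVlt => /predU1P[<-|bt].
  have -> : (k b - k t0) / e * (b - t0) = k b - k t0.
    by rewrite /b; field; rewrite gt_eqF.
  lra.
have h := Gamma_chord Ggamma g0 b0 bt.
rewrite -(ler_pM2l e0) mulrDr.
have -> : e * ((k b - k t0) / e * (t - t0)) = (k b - k t0) * (t - t0).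
  by field; rewrite gt_eqF.
rewrite -/(k _) -/(k _) -/(k _) in h.
have E : b - t0 = e by rewrite /b; ring.
rewrite E in h.
have : (t - b) * k t0 = (t - t0) * k t0 - e * k t0 by rewrite /b; ring.
lra.
Qed.

(** Mirror image of [subgradient_right]. Points to the left may leave the domain, where [k] takes
    the default value 0 instead of [+oo]; hence the finiteness condition on [gamma t]. *)
Lemma subgradient_left (r t0 e : R) : subgradient r t0 -> 0 < e ->
  exists2 c, 0 < c & forall t, gamma t \is a fin_num -> t <= t0 - e ->
    k t0 + (r - c) * (t - t0) <= k t.
Proof.
move=> sg e0; have g0 := sg.1; have := Gamma_dom Ggamma g0.
rewrite le_eqVlt => /predU1P[t00|t00].
  (* For [t0 = 0] the domain has no point to the left, so any positive margin serves. *)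
  by exists 1 => // t /(Gamma_dom Ggamma); lra.
pose d := Num.min e (t0 / 2).
have d0 : 0 < d by rewrite lt_min e0/=; lra.
have de : d <= e by rewrite ge_min lexx.
have dt : d <= t0 / 2 by rewrite ge_min lexx orbT.
pose a := t0 - d; have a0 : a < t0 by rewrite /a; lra.
have ga : gamma a \is a fin_num by rewrite (Gamma_fin Ggamma)// /a; lra.
have m1 : a < t0 - d / 2 by rewrite /a; lra.
have m2 : t0 - d / 2 < t0 by lra.
have gm : gamma (t0 - d / 2) \is a fin_num by rewrite (Gamma_fin Ggamma)//; lra.
have h1 := Gamma_chord Ggamma ga m1 m2.
have h2 := subgradient_fine sg gm.
have d20 : 0 < d / 2 by lra.
have h3 : d * (k t0 - r * (d / 2)) <= d * k (t0 - d / 2).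
  by rewrite ler_pM2l//; lra.
have ka : - (r * d) < k a - k t0.
  rewrite -(ltr_pM2l d20).
  have -> : d / 2 * (k a - k t0) = (t0 - (t0 - d / 2)) * k a + (t0 - d / 2 - a) * k t0 - d * k t0.
    by rewrite /a; field.
  have : (t0 - a) * k (t0 - d / 2) = d * k (t0 - d / 2) by rewrite /a; ring.
  rewrite /k in h1 h3 *; lra.
exists ((k a - k t0) / d + r).
  suff : - r < (k a - k t0) / d by lra.
  by rewrite ltr_pdivlMr//; lra.
move=> t gt te; have : t <= a by rewrite /a; lra.
have -> : r - ((k a - k t0) / d + r) = - ((k a - k t0) / d) by ring.
rewrite le_eqVlt => /predU1P[->|ta].
  have -> : - ((k a - k t0) / d) * (a - t0) = k a - k t0.
    by rewrite /a; field; rewrite gt_eqF.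
  lra.
have h := Gamma_chord Ggamma gt ta a0.
rewrite -/(k _) -/(k _) -/(k _) in h.
rewrite -(ler_pM2l d0) mulrDr.
have -> : d * (- ((k a - k t0) / d) * (t - t0)) = - (k a - k t0) * (t - t0).
  by field; rewrite gt_eqF.
have E : t0 - a = d by rewrite /a; ring.
rewrite E in h.
have : (a - t) * k t0 = (t0 - t) * k t0 - d * k t0 by rewrite /a; ring.
lra.
Qed.

Lemma conjugate_subgradient (r t0 : R) : subgradient r t0 ->
  conjugate gamma r = (r * t0 - k t0)%:E.
Proof.
move=> sg; have g0 := sg.1; apply/eqP; rewrite eq_le; apply/andP; split.
  apply: ge_ereal_sup => _ [t _ <-].
  have [gt|] := boolP (gamma t \is a fin_num).
    by rewrite -(fineK gt) -EFinB lee_fin -/(k t); have := subgradient_fine sg gt; lra.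
  by move=> /(Gamma_pinfty Ggamma) ->; rewrite leNye.
by apply: ereal_sup_ubound; exists t0 => //; rewrite EFinB fineK.
Qed.

(* Strict convexity makes the subgradient inequality strict, by a margin
   [c |t - t0|], away from [t0]. *)
Lemma conjugate_near_subgradient (r t0 e : R) : subgradient r t0 -> 0 < e ->
  exists2 c, 0 < c & forall s, `|s - r| <= c ->
    ((s * t0 - k t0)%:E <= conjugate gamma s <=
     (s * t0 - k t0 + e * `|s - r|)%:E)%E.
Proof.
move=> sg e0; have g0 := sg.1.
have [c1 c10 H1] := subgradient_right sg e0.
have [c2 c20 H2] := subgradient_left sg e0.
exists (Num.min c1 c2); first by rewrite lt_min c10.
move=> s; rewrite le_min => /andP[sc1 sc2]; apply/andP; split.
  by apply: ereal_sup_ubound; exists t0 => //; rewrite EFinB fineK.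
apply: ge_ereal_sup => _ [t _ <-].
have [gt|] := boolP (gamma t \is a fin_num); last first.
  by move=> /(Gamma_pinfty Ggamma) ->; rewrite leNye.
rewrite -(fineK gt) -EFinB lee_fin -/(k t).
have N0 : 0 <= e * `|s - r| by rewrite mulr_ge0// ltW.
move: sc1 sc2; rewrite !ler_norml => /andP[_ s1] /andP[s2 _].
(* At distance at least [e] from [t0] the margins [c1] and [c2] absorb the change of slope from [r]
   to [s]; closer to [t0] this change costs at most [e |s - r|]. *)
have [tl|tl] := leP t (t0 - e).
  have := H2 t gt tl.
  have : 0 <= (s - r + c2) * (t0 - t) by rewrite mulr_ge0//; lra.
  lra.
have [tr|tr] := leP (t0 + e) t.
  have := H1 t tr.
  have : 0 <= (r + c1 - s) * (t - t0) by rewrite mulr_ge0//; lra.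
  lra.
have := subgradient_fine sg gt.
suff : (s - r) * (t - t0) <= e * `|s - r| by lra.
rewrite (le_trans (ler_norm _))// normrM mulrC ler_wpM2r// ler_norml.
by apply/andP; split; lra.
Qed.

Lemma conjugate_finite_near (r t0 : R) : subgradient r t0 ->
  finite_near (conjugate gamma) r.
Proof.
move=> sg; have [c c0 H] := conjugate_near_subgradient sg ltr01.
rewrite /finite_near; near=> s.
have /H/andP[h1 h2] : `|s - r| <= c.
  by rewrite distrC; near: s; exact: (@cvgr_dist_le _ _ _ (nbhs r) _ id r cvg_id _ c0).
by apply: fin_num_between; apply/andP; split; [exact: h1|exact: h2].
Unshelve. all: by end_near. Qed.


(** Near [r] the conjugate exceeds its affine minorant of slope [t0] by at most [e |s - r|], so the
    difference quotients at [r] are within [e] of [t0]. *)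
Lemma conjugate_is_derive (r t0 : R) : subgradient r t0 ->
  is_derive r 1 (fine \o conjugate gamma) t0.
Proof.
move=> sg.
have cv : (fun h : R => h^-1 *: ((fine \o conjugate gamma) (h *: 1 + r) -
    (fine \o conjugate gamma) r)) @ 0^' --> t0.
  apply/cvgrPdist_le => /= e e0.
  have [c c0 H] := conjugate_near_subgradient sg e0.
  near=> h.
  have h0 : h != 0 by near: h; exact: nbhs_dnbhs_neq.
  have hc : `|h| <= c.
    by near: h; exact: dnbhs0_le.
  rewrite (conjugate_subgradient sg) /= /GRing.scale/= mulr1.
  have := H (h + r); rewrite addrK => /(_ hc) hr.
  have fh := fin_num_between hr.
  move: hr; rewrite -(fineK fh) !lee_fin => /andP[h1 h2].
  set F := fine (conjugate gamma (h + r)) in h1 h2 *.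
  have -> : t0 - h^-1 * (F - (r * t0 - k t0)) =
      - h^-1 * (F - ((h + r) * t0 - k t0)) by field.
  rewrite normrM normrN normfV ger0_norm ?subr_ge0//.
  by rewrite mulrC ler_pdivrMr ?normr_gt0//; lra.
split; last exact/cvg_lim.
by apply/cvg_ex; exists t0.
Unshelve. all: by end_near. Qed.

Lemma conjugate_derive (r t0 : R) : subgradient r t0 ->
  ederivable (conjugate gamma) r /\ ederive (conjugate gamma) r = t0.
Proof.
move=> sg; have D := conjugate_is_derive sg; split.
  by split; [exact: conjugate_finite_near sg|exact: ex_derive].
by rewrite /ederive derive1E derive_val.
Qed.

(** Finiteness at [r1] gives [gamma] an affine minorant of slope [r1 > r], so [k t - r t] grows at
    least linearly and its minimum can be sought on a compact interval. *)
Lemma conjugate_attained (r r1 : R) : r < r1 ->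
  conjugate gamma r1 \is a fin_num -> exists t0, subgradient r t0.
Proof.
move=> rr1 cr1.
pose M := fine (conjugate gamma r1).
have Mle t : gamma t \is a fin_num -> r1 * t - M <= k t.
  move=> gt; have : ((r1 * t)%:E - gamma t <= conjugate gamma r1)%E.
    by apply: ereal_sup_ubound; exists t.
  by rewrite -(fineK cr1) -(fineK gt) -EFinB lee_fin -/M -/(k t); lra.
pose psi t := k t - r * t.
(* For [t > T] the minorant gives [psi t >= (r1 - r) t - M >= psi 1], and [T >= 1] keeps the
   comparison point 1 inside the interval. *)
pose T := 1 + (`|M| + `|psi 1|) / (r1 - r).
have d0 : 0 < r1 - r by lra.
have T1 : 1 <= T by rewrite lerDl divr_ge0 ?(ltW d0)// addr_ge0.
have tail t : T < t -> psi 1 <= psi t.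
  move=> Tt; have gt : gamma t \is a fin_num by rewrite (Gamma_fin Ggamma)//; lra.
  have h1 := Mle t gt.
  have h2 : `|M| + `|psi 1| <= (r1 - r) * t.
    rewrite mulrC -ler_pdivrMr// (le_trans _ (ltW Tt))// /T; lra.
  have := ler_norm M; have := ler_norm (psi 1); rewrite /psi; rewrite /psi in h2.
  lra.
have fin t : 0 < t -> gamma t \is a fin_num by move=> t0; rewrite (Gamma_fin Ggamma).
have psic t : 0 < t -> {for t, continuous psi}.
  move=> t0; apply: cvgB; first exact: (Gamma_continuous Ggamma).
  by apply: cvgMr; exact: cvg_id.
have sgP t0 : gamma t0 \is a fin_num ->
    (forall t, gamma t \is a fin_num -> psi t0 <= psi t) -> subgradient r t0.
  move=> g0 h; apply: subgradientP => // t gt; have := h t gt; rewrite /psi; lra.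
have [g0|g0] := boolP (gamma 0 \is a fin_num).
  have T0 : 0 < T by lra.
  have : {within `[0, T], continuous psi}.
    apply/continuous_within_itvP => //; split.
    - by move=> x; rewrite in_itv/= => /andP[x0 _]; exact: psic.
    - apply: cvgB; first exact: (Gamma_cvg0 Ggamma).
      by apply: cvgMr; exact: cvg_at_right_filter cvg_id.
    - apply: cvg_at_left_filter; exact: psic.
  move=> /(EVT_min (ltW T0))[c]; rewrite in_itv/= => /andP[c0 cT] cmin.
  have gc : gamma c \is a fin_num.
    by move: c0; rewrite le_eqVlt => /predU1P[<-//|]; exact: fin.
  exists c; apply: sgP => // t gt; have t0 := Gamma_dom Ggamma gt.
  have [tT|Tt] := leP t T; first by apply: cmin; rewrite in_itv/= t0.
  by apply: le_trans (tail _ Tt); apply: cmin; rewrite in_itv/= ler01.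
have g0y := Gamma_pinfty Ggamma g0.
(* Here [gamma] tends to [+oo] at 0, so the interval is cut at [e]. Near 0 one has
   [k t > psi 1 + |r|], and [r t <= |r|] for [t < 1]. *)
have [e [e0 e1 He]] : exists e : R, [/\ 0 < e, e < 1 &
    forall t, 0 < t -> t < e -> psi 1 <= psi t].
  have : gamma t @[t --> 0^'+] --> +oo%E by rewrite -g0y; case: Ggamma.
  move=> /cvgeyPgt/(_ (psi 1 + `|r|)) [] /= e e0 He.
  exists (Num.min e (1 / 2)); split.
  - by rewrite lt_min e0/=; lra.
  - by rewrite gt_min; apply/orP; right; lra.
  - move=> t t0; rewrite lt_min => /andP[te t2].
    have := He t; rewrite /= sub0r normrN gtr0_norm// => /(_ te t0).
    rewrite -(fineK (fin _ t0)) lte_fin -/(k t) => h.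
    have : r * t <= `|r| * t by rewrite ler_wpM2r ?ler_norm// ltW.
    have : `|r| * t <= `|r| * 1 by rewrite ler_wpM2l//; lra.
    rewrite /psi in h *; lra.
have eT : e < T by lra.
have : {within `[e, T], continuous psi}.
  apply: continuous_in_subspaceT => x; rewrite inE/= in_itv/= => /andP[ex _].
  by apply: psic; lra.
move=> /(EVT_min (ltW eT))[c]; rewrite in_itv/= => /andP[c0 cT] cmin.
exists c; apply: sgP; first by apply: fin; lra.
move=> t gt; have := Gamma_dom Ggamma gt; rewrite le_eqVlt => /predU1P[t0|t0].
  by rewrite -t0 (negPf g0) in gt.
have c1 : psi c <= psi 1 by apply: cmin; rewrite in_itv/=; apply/andP; split; lra.
have [te|et] := ltP t e; first exact: le_trans c1 (He _ t0 te).
have [tT|Tt] := leP t T; first by apply: cmin; rewrite in_itv/= et.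
exact: le_trans (tail _ Tt).
Qed.

Lemma finite_near_subgradient (r : R) : finite_near (conjugate gamma) r ->
  exists t0, subgradient r t0.
Proof.
move=> /nbhs_ballP[e /= e0 He].
apply: (@conjugate_attained r (r + e / 2)); first by lra.
apply: He; rewrite -ball_normE/=.
by rewrite opprD addNKr normrN gtr0_norm; lra.
Qed.

(** By right continuity any point of the domain may be replaced by a slightly larger rational. The
    resulting countable supremum serves both measurability and the choice of a single null set for
    all [t]. *)
Lemma conjugate_rat (r : R) : conjugate gamma r =
  ereal_sup [set ((r * ratr q)%:E - gamma (ratr q))%E | q in [set q : rat | 0 < q]].
Proof.
apply/eqP; rewrite eq_le; apply/andP; split; last first.
  by apply: le_ereal_sup => _ [q _ <-]; exists (ratr q).
apply: ge_ereal_sup => _ [t _ <-].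
have [gt|] := boolP (gamma t \is a fin_num); last first.
  by move=> /(Gamma_pinfty Ggamma) ->; rewrite leNye.
have t0 := Gamma_dom Ggamma gt.
apply/lee_addgt0Pr => e e0.
have cv : ((r * s)%:E - gamma s)%E @[s --> t^'+] --> ((r * t)%:E - gamma t)%E.
  apply: cvgeB.
  - by rewrite fin_num_adde_defl// fin_numN.
  - apply: cvg_EFin; first exact: nearW.
    by apply: cvgMr; exact: cvg_at_right_filter cvg_id.
  - exact: (Gamma_right_continuous Ggamma).
have fv : ((r * t)%:E - gamma t)%E \is a fin_num by rewrite fin_numB gt.
have : nbhs ((r * t)%:E - gamma t)%E [set y | ((r * t)%:E - gamma t - e%:E < y)%E].
  apply: open_nbhs_nbhs; split; first exact: open_ereal_gt_ereal.
  by rewrite /= -(fineK fv) lte_fin; lra.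
move=> /cv[d /= d0 Hd].
have td : t < t + d by lra.
have [q] := rat_in_itvoo td; rewrite in_itv/= => /andP[tq qd].
have q0 : 0 < q by rewrite -(@ltr0q R); lra.
have := Hd (ratr q); rewrite /= => /(_ _ tq) h.
rewrite -leeBlDr//; apply: le_trans (ltW (h _)) _.
  by rewrite ltr0_norm; lra.
by apply: ereal_sup_ubound; exists q.
Qed.

End conjugate_derivative.

(** * Measurability and integration *)

Section measurability.
Context d (Z : measurableType d) (R : realType).

Lemma measurable_countable_choice (N : Z -> nat) (F : nat -> Z -> \bar R) :
  (forall m, measurable [set z | N z = m]) ->
  (forall m, measurable_fun [set: Z] (F m)) ->
  measurable_fun [set: Z] (fun z => F (N z) z).
Proof.
move=> mN mF _ Y mY; rewrite setTI.
have -> : (fun z => F (N z) z) @^-1` Y =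
    \bigcup_m ([set z | N z = m] `&` (F m @^-1` Y)).
  apply/seteqP; split=> [z Yz|z [m _ [/= <-]]//]; first by exists (N z).
apply: bigcup_measurable => m _; apply: measurableI => //.
by rewrite -[X in measurable X]setTI; exact: mF.
Qed.

Variable beta : Z -> R -> \bar R.
Hypothesis Bbeta : class_B beta.

(** The functions [u k] take countably many positive values and satisfy
    [g < u k <= g + 1 / (k + 1)]; the strict excess allows right continuity to pass to the limit
    even where [g] vanishes. *)
Lemma measurable_integrand (g : Z -> R) : measurable_fun [set: Z] g ->
  (forall z, 0 <= g z) -> measurable_fun [set: Z] (fun z => beta z (g z)).
Proof.
move=> mg g0.
pose N (k : nat) z := Num.truncn (k.+1%:R * g z).
pose u k z : R := (N k z).+1%:R / k.+1%:R.
have Nitv k z : (N k z)%:R <= k.+1%:R * g z < (N k z).+1%:R.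
  by apply: truncn_itv; rewrite mulr_ge0.
apply: (@emeasurable_fun_cvg _ _ _ _ (fun k z => beta z (u k z))).
  move=> k; apply: (measurable_countable_choice
    (F := fun m z => beta z (m.+1%:R / k.+1%:R))) => m; last first.
    exact: Bbeta.1.
  have -> : [set z | N k z = m] = (fun z => k.+1%:R * g z) @^-1` `[m%:R, m.+1%:R[.
    apply/seteqP; split=> z /=; rewrite in_itv/=.
      by move=> <-; exact: Nitv.
    by move=> /truncn_def.
  have mkg : measurable_fun [set: Z] (fun z => k.+1%:R * g z).
    exact: measurable_funM.
  rewrite -[X in measurable X]setTI; apply: mkg => //; exact: measurable_itv.
move=> z _; apply: (cvg_comp _ _ _ (Gamma_right_continuous (Bbeta.2 z) (g0 z))).
move=> P [e /= e0 He].
have [k0 _ Hk0] := near_infty_natSinv_lt (PosNum e0).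
exists k0 => // k /Hk0 /= kd; have /andP[N1 N2] := Nitv k z.
have k1 : (0 : R) < k.+1%:R by [].
apply: He; last by rewrite /u ltr_pdivlMr// mulrC.
rewrite /= ltr0_norm; last by rewrite subr_lt0 /u ltr_pdivlMr// mulrC.
apply: le_lt_trans kd.
rewrite opprB lerBlDl /u ler_pdivrMr// mulrDl mulVf ?gt_eqF// mulrC.
by rewrite -natr1 lerD2r.
Qed.

Lemma measurable_conjugate (D : set Z) (r : Z -> R) :
  measurable_fun D r ->
  measurable_fun D (fun z => conjugate (beta z) (r z)).
Proof.
move=> mr.
(* The sequence [q] runs through all positive rationals; codes of no rational or of a nonpositive
   one are sent to 1. *)
pose pos_rat (p : rat) : rat := if 0 < p then p else 1.
pose q n : rat := pos_rat (odflt 1 (unpickle n)).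
pose F n z := ((r z * ratr (q n))%:E - beta z (ratr (q n)))%E.
have -> : (fun z => conjugate (beta z) (r z)) = (fun z => esups (F^~ z) 0%N).
  apply/funext => z; rewrite (conjugate_rat (Bbeta.2 z)); congr ereal_sup.
  apply/seteqP; split.
    by move=> _ [p /= p0 <-]; exists (pickle p) => //; rewrite /F /q pickleK /pos_rat/= p0.
  by move=> _ [n _ <-]; exists (q n) => //=; rewrite /q /pos_rat; case: ifP.
apply: measurable_fun_esups => n mD; apply: emeasurable_funB => //.
  by apply/measurable_EFinP; exact: measurable_funM.
apply: measurable_funTS; exact: Bbeta.1.
Qed.

End measurability.

Section pintegral_lemmas.
Context d (Z : measurableType d) (R : realType) (mu : {measure set Z -> \bar R}).

(** The integrable majorant bounds the positive part of [f], which excludes the branch where the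
    convention sets the integral to [+oo]. *)
Lemma pintegral_le (D : set Z) (f w : Z -> \bar R) : measurable D ->
  measurable_fun D f -> mu.-integrable D w ->
  {ae mu, forall z, D z -> (f z <= w z)%E} ->
  (pintegral mu D f <= \int[mu]_(z in D) w z)%E.
Proof.
move=> mD mf iw fw.
have mw := measurable_int _ iw.
have pos : (\int[mu]_(z in D) f^\+ z <= \int[mu]_(z in D) w^\+ z)%E.
  apply: ae_ge0_le_integral => //; [exact: measurable_funepos|exact: measurable_funepos|].
  by apply: filterS fw => z fw Dz; rewrite !funeposE ge_max !le_max lexx (fw Dz) orbT.
have neg : (\int[mu]_(z in D) w^\- z <= \int[mu]_(z in D) f^\- z)%E.
  apply: ae_ge0_le_integral => //; [exact: measurable_funeneg|exact: measurable_funeneg|].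
  apply: filterS fw => z fw Dz.
  by rewrite !funenegE ge_max !le_max lexx orbT leeN2 (fw Dz).
have wp : (\int[mu]_(z in D) w^\+ z < +oo)%E by exact: integral_funepos_lt_pinfty.
rewrite /pintegral; case: ifP => [/andP[/eqP pE _]|_].
  by move: (le_lt_trans pos wp); rewrite pE.
by rewrite integralE [leRHS]integralE leeB.
Qed.

Lemma pintegral_fin (D : set Z) (f : Z -> \bar R) : measurable D ->
  measurable_fun D f -> pintegral mu D f \is a fin_num ->
  mu.-integrable D f /\ pintegral mu D f = (\int[mu]_(z in D) f z)%E.
Proof.
move=> mD mf; rewrite /pintegral; case: ifPn => // nb fi; split=> //.
have p0 : (0 <= \int[mu]_(z in D) f^\+ z)%E by apply: integral_ge0.
have n0 : (0 <= \int[mu]_(z in D) f^\- z)%E by apply: integral_ge0.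
apply/integrableP; split=> //.
have -> : (fun z => `|f z|%E) = (f^\+ \+ f^\-)%E by rewrite -fune_abse.
rewrite ge0_integralD//; [|exact: measurable_funepos|exact: measurable_funeneg].
move: fi nb p0 n0; rewrite integralE.
by case: (\int[mu]_(z in D) f^\+ z)%E => [x||]; case: (\int[mu]_(z in D) f^\- z)%E => [y||] //=; rewrite -?EFinD ?ltry ?eqxx //=.
Qed.

Lemma ae_eq_of_le_integral (f g : Z -> R) :
  mu.-integrable [set: Z] (EFin \o f) -> mu.-integrable [set: Z] (EFin \o g) ->
  {ae mu, forall z, f z <= g z} ->
  \int[mu]_z g z <= \int[mu]_z f z -> {ae mu, forall z, f z = g z}.
Proof.
move=> fi gi fg gf; pose h z := g z - f z.
have hi : mu.-integrable [set: Z] (EFin \o h) by exact: (integrableB measurableT gi fi).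
have mh := measurable_int _ hi.
have h0 : \int[mu]_z h z <= 0 by rewrite RintegralB// subr_le0.
have : (\int[mu]_z `|(h z)%:E| = 0)%E.
  apply/eqP; rewrite eq_le integral_ge0// andbT.
  rewrite (@ae_eq_integral _ _ _ mu setT (EFin \o h))//; last first.
  - apply: filterS fg => z fgz _ /=.
    by rewrite ger0_norm// subr_ge0.
  - exact: measurableT_comp.
  by rewrite -(fineK (integrable_fin_num _ hi))// lee_fin.
move=> /ae_eq_integral_abs -/(_ measurableT mh); apply: filterS => z /= /(_ I) [].
by move/subr0_eq.
Qed.

End pintegral_lemmas.

(** * Faces of convex cones *)

Section faces_of_cones.
Variables (R : realType) (n : nat).
Implicit Types (C F : set 'rV[R]_n) (x y u a : 'rV[R]_n).

Lemma convex_cone_segment C x y : convex_cone C -> C x -> C y ->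
  closed_segment x y `<=` C.
Proof.
move=> [_ CD CZ] Cx Cy _ [t /= + <-]; rewrite in_itv/= => /andP[t0 t1].
by apply: CD; apply: CZ => //; rewrite subr_ge0.
Qed.

Lemma closed_segmentP x y (t : R) : 0 <= t -> t <= 1 ->
  closed_segment x y ((1 - t) *: x + t *: y).
Proof. by move=> t0 t1; exists t => //=; rewrite in_itv/= t0. Qed.

Lemma open_segmentP x y (t : R) : 0 < t -> t < 1 ->
  open_segment x y ((1 - t) *: x + t *: y).
Proof. by move=> t0 t1; exists t => //=; rewrite in_itv/= t0. Qed.

Lemma midpointE x y :
  (1 - 2^-1) *: ((2 : R) *: x) + 2^-1 *: ((2 : R) *: y) = x + y.
Proof. by apply/rowP => i; rewrite !mxE; field. Qed.

(** A point [x] of [F] is interior to the segment from 0 to [(t + 1) x], which therefore lies in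
    [F]; this gives 0 and all multiples. A sum is the midpoint of the doubled vectors. *)
Lemma face_convex_cone C F : convex_cone C -> face C F -> convex_cone F.
Proof.
move=> coneC [[w Fw] Fconv FC Fext].
have [C0 CD CZ] := coneC.
have ray x (t : R) : F x -> 0 < t -> closed_segment 0 ((t + 1) *: x) `<=` F.
  move=> Fx t0; apply: Fext.
    by apply: convex_cone_segment => //; apply: CZ; [lra|exact: FC].
  have t10 : 0 < t + 1 by lra.
  exists x; split=> //; have := @open_segmentP 0 ((t + 1) *: x) (t + 1)^-1.
  rewrite scaler0 add0r scalerA mulVf ?gt_eqF// scale1r; apply.
    by rewrite invr_gt0.
  by rewrite invf_lt1//; lra.
have F0 : F 0.
  apply: (ray w 1 Fw ltr01).
  by have := @closed_segmentP 0 ((1 + 1) *: w) 0 (lexx _) ler01; rewrite scaler0 scale0r addr0.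
have FZ (t : R) x : 0 <= t -> F x -> F (t *: x).
  rewrite le_eqVlt => /predU1P[<-|t0] Fx; first by rewrite scale0r.
  apply: (ray x t Fx t0).
  have t10 : 0 < t + 1 by lra.
  have := @closed_segmentP 0 ((t + 1) *: x) (t / (t + 1)).
  rewrite scaler0 add0r scalerA divfK ?gt_eqF//; apply.
    by rewrite divr_ge0//; lra.
  by rewrite ler_pdivrMr//; lra.
split=> // x y Fx Fy.
have two0 : 0 <= 2 :> R by [].
have h0 : 0 <= 2^-1 :> R by lra.
have h1 : 2^-1 <= 1 :> R by lra.
have := Fconv ((2 : R) *: x) ((2 : R) *: y) (Itv01 h0 h1).
rewrite !inE => /(_ (FZ _ _ two0 Fx) (FZ _ _ two0 Fy)).
have h2 : (1 - 2^-1 : R) = 2^-1 by lra.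
by rewrite -(midpointE x y) /conv/= /unstable.onem h2.
Qed.

Lemma face_split C F x y : convex_cone C -> face C F ->
  C x -> C y -> F (x + y) -> F x.
Proof.
move=> coneC faceF Cx Cy Fxy; have [_ _ CZ] := coneC.
have [_ _ FZ] := face_convex_cone coneC faceF.
have [_ _ _ Fext] := faceF.
have two0 : 0 <= 2 :> R by [].
have F2x : F ((2 : R) *: x).
  apply: (Fext ((2 : R) *: x) ((2 : R) *: y)).
  - by apply: convex_cone_segment => //; exact: CZ.
  - exists (x + y); split=> //; rewrite -midpointE.
    by apply: open_segmentP; lra.
  - have := @closed_segmentP ((2 : R) *: x) ((2 : R) *: y) 0 (lexx _) ler01.
    by rewrite subr0 scale1r scale0r addr0.
have -> : x = 2^-1 *: ((2 : R) *: x) by rewrite scalerA mulVf// scale1r.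
by apply: FZ => //; rewrite invr_ge0.
Qed.

(** For a convex cone [C] containing [a] this is the smallest face containing [a]: the elements of
    [C] having a positive multiple below [a] in the order of [C]. *)
Definition minimal_face C a : set 'rV[R]_n :=
  [set x | C x /\ exists2 t : R, 0 < t & C (a - t *: x)].

Lemma minimal_face_self C a : convex_cone C -> C a -> minimal_face C a a.
Proof.
by move=> [C0 _ _] Ca; split=> //; exists 1 => //; rewrite scale1r subrr.
Qed.

(** This is the form in which [a] being in the relative interior of its minimal face is used: from
    [a] one can move away from any [x] of the face and stay in it. *)
Lemma minimal_face_sub C a x : convex_cone C -> C a -> minimal_face C a x ->
  exists2 t : R, 0 < t & minimal_face C a (a - t *: x).
Proof.
move=> [_ CD CZ] Ca [Cx [t t0 Cax]]; exists t => //; split=> //.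
by exists 1 => //; rewrite scale1r subKr; apply: CZ => //; exact: ltW.
Qed.

Lemma minimal_face_face C a : convex_cone C -> C a -> face C (minimal_face C a).
Proof.
move=> coneC Ca; have [C0 CD CZ] := coneC; split.
- by exists a; exact: minimal_face_self.
- apply/convex_setW => x y; rewrite !inE => -[Cx [s s0 Cs]] [Cy [t t0 Ct]] k k0 k1.
  have kk : 0 < 1 - k%:num by lra.
  have -> : conv k x y = k%:num *: x + (1 - k%:num) *: y by [].
  rewrite inE; split; first by apply: CD; apply: CZ => //; exact: ltW.
  exists (Num.min s t); first by rewrite lt_min s0.
  have sub r z : 0 < r -> Num.min s t <= r -> C z -> C (a - r *: z) ->
      C (a - Num.min s t *: z).
    move=> r0 mr Cz Cr.
    have -> : a - Num.min s t *: z = (a - r *: z) + (r - Num.min s t) *: z.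
      by rewrite scalerBl addrA subrK.
    by apply: CD => //; apply: CZ => //; rewrite subr_ge0.
  have -> : a - Num.min s t *: (k%:num *: x + (1 - k%:num) *: y) =
      k%:num *: (a - Num.min s t *: x) + (1 - k%:num) *: (a - Num.min s t *: y).
    by apply/rowP => i; rewrite !mxE; ring.
  apply: CD; apply: CZ; rewrite ?(ltW kk)//.
    by apply: (sub s) => //; rewrite ge_min lexx.
  by apply: (sub t) => //; rewrite ge_min lexx orbT.
- by move=> x [].
move=> x y segC [_ [[t /= + <-]]]; rewrite in_itv/= => /andP[t0 t1] [_ [s s0 Cs]].
have Cx : C x.
  have := @closed_segmentP x y 0 (lexx _) ler01.
  by rewrite subr0 scale1r scale0r addr0 => /segC.
have Cy : C y.
  have := @closed_segmentP x y 1 ler01 (lexx _).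
  by rewrite subrr scale1r scale0r add0r => /segC.
have t10 : 0 < 1 - t by lra.
(* Giving back the [y] part of the subtracted point, which lies in [C], leaves only a multiple of
   [x] subtracted. *)
have Cax : C (a - (s * (1 - t)) *: x).
  have -> : a - (s * (1 - t)) *: x =
      a - s *: ((1 - t) *: x + t *: y) + (s * t) *: y.
    by apply/rowP => i; rewrite !mxE; ring.
  by apply: CD => //; apply: CZ => //; rewrite mulr_ge0 ?ltW.
have Cay : C (a - (s * t) *: y).
  have -> : a - (s * t) *: y =
      a - s *: ((1 - t) *: x + t *: y) + (s * (1 - t)) *: x.
    by apply/rowP => i; rewrite !mxE; ring.
  by apply: CD => //; apply: CZ => //; rewrite mulr_ge0 ?ltW.
have st0 := mulr_gt0 s0 t0; have st1 := mulr_gt0 s0 t10.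
move=> _ [l /= + <-]; rewrite in_itv/= => /andP[l0 l1].
have ml0 : 0 <= 1 - l by lra.
split; first by apply: CD; apply: CZ.
exists (2^-1 * Num.min (s * t) (s * (1 - t))).
  by rewrite mulr_gt0// lt_min st0 st1.
set m := Num.min _ _.
have m0 : 0 < m by rewrite lt_min st0 st1.
have Sub r z : 0 < r -> m <= r -> C z -> C (a - r *: z) -> C (a - m *: z).
  move=> r0 mr Cz Cr.
  have -> : a - m *: z = (a - r *: z) + (r - m) *: z.
    by rewrite scalerBl addrA subrK.
  by apply: CD => //; apply: CZ => //; rewrite subr_ge0.
have Cmx : C (a - m *: x) by apply: (Sub (s * (1 - t))) => //; rewrite ge_min lexx orbT.
have Cmy : C (a - m *: y) by apply: (Sub (s * t)) => //; rewrite ge_min lexx.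
have -> : a - (2^-1 * m) *: ((1 - l) *: x + l *: y) = 2^-1 *: a +
    2^-1 *: ((1 - l) *: (a - m *: x) + l *: (a - m *: y)).
  by apply/rowP => i; rewrite !mxE; field.
have h20 : 0 <= 2^-1 :> R by lra.
exact: (CD _ _ (CZ _ _ h20 Ca) (CZ _ _ h20 (CD _ _ (CZ _ _ ml0 Cmx) (CZ _ _ l0 Cmy)))).
Qed.

End faces_of_cones.

(** * Moments *)

Section moments.
Context d (Z : measurableType d) (R : realType) (n : nat).
Variables (mu : {measure set Z -> \bar R}) (phi : Z -> 'rV[R]_n).
Hypothesis mphi : forall i, measurable_fun [set: Z] (fun z => phi z ord0 i).

Local Notation G := (class_G mu phi).
Local Notation Gpos := (class_Gpos mu phi).
Local Notation integrableT f := (mu.-integrable [set: Z] (EFin \o f)).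

Lemma ae_le_integrable (f g : Z -> R) : measurable_fun [set: Z] f ->
  integrableT g -> {ae mu, forall z, `|f z| <= `|g z|} -> integrableT f.
Proof.
move=> mf /integrableP[mg gi] fg; apply/integrableP; split.
  exact/measurable_EFinP.
apply: le_lt_trans gi; apply: ae_ge0_le_integral => //.
- by apply: measurableT_comp => //; exact/measurable_EFinP.
- exact: measurableT_comp.
- by apply: filterS fg => z /= fgz _; rewrite lee_fin.
Qed.

Lemma integrable_sum_seq (I : Type) (s : seq I) (F : I -> Z -> R) :
  (forall i, integrableT (F i)) ->
  integrableT (fun z => \sum_(i <- s) F i z) /\
  \int[mu]_z (\sum_(i <- s) F i z) = \sum_(i <- s) \int[mu]_z F i z.
Proof.
move=> iF; elim: s => [|i s [IH1 IH2]].
  under eq_fun do rewrite big_nil.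
  split; first exact: integrable0.
  by rewrite big_nil Rintegral_cst// mul0r.
under eq_fun do rewrite big_cons.
split; first exact: (integrableD measurableT (iF i) IH1).
by rewrite RintegralD// IH2 big_cons.
Qed.

Lemma inner_moment (th : 'rV[R]_n) (g : Z -> R) : G g ->
  integrableT (fun z => inner th (phi z) * g z) /\
  \int[mu]_z (inner th (phi z) * g z) = inner th (moment mu phi g).
Proof.
move=> [mg ig].
have iF (i : 'I_n) : integrableT (fun z => th ord0 i * (phi z ord0 i * g z)).
  exact: (integrableZl measurableT (th ord0 i) (ig i)).
have [h1 h2] := integrable_sum_seq (index_enum 'I_n) iF.
have E : (fun z => inner th (phi z) * g z) =
    (fun z => \sum_(i < n) th ord0 i * (phi z ord0 i * g z)).
  apply/funext => z; rewrite /inner mulr_suml.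
  by apply: eq_bigr => i _; rewrite mulrA.
rewrite E; split=> //.
rewrite h2; apply: eq_bigr => i _; rewrite mxE RintegralZl//; exact: ig.
Qed.

Lemma class_G_dom (g h : Z -> R) : G g -> measurable_fun [set: Z] h ->
  {ae mu, forall z, `|h z| <= `|g z|} -> G h.
Proof.
move=> [mg ig] mh hg; split=> // i.
apply: (ae_le_integrable _ (ig i)); first exact: measurable_funM.
by apply: filterS hg => z hgz; rewrite !normrM ler_wpM2l.
Qed.

Lemma moment_ae (g h : Z -> R) : G g -> G h -> g = h %[ae mu] ->
  moment mu phi g = moment mu phi h.
Proof.
move=> [mg ig] [mh ih] gh; apply/rowP => i; rewrite !mxE /Rintegral.
congr fine; apply: ae_eq_integral => //.
- exact: measurable_int (ig i).
- exact: measurable_int (ih i).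
- by apply: filterS gh => z /= /(_ I) ghz _; rewrite ghz.
Qed.

Lemma moment_lin (s t : R) (g h : Z -> R) : G g -> G h ->
  G (fun z => s * g z + t * h z) /\
  moment mu phi (fun z => s * g z + t * h z) =
  s *: moment mu phi g + t *: moment mu phi h.
Proof.
move=> [mg ig] [mh ih].
have E i : (fun z => phi z ord0 i * (s * g z + t * h z)) =
    (fun z => s * (phi z ord0 i * g z) + t * (phi z ord0 i * h z)).
  by apply/funext => z; ring.
have is_ i : integrableT (fun z => s * (phi z ord0 i * g z)).
  exact: (integrableZl measurableT s (ig i)).
have it_ i : integrableT (fun z => t * (phi z ord0 i * h z)).
  exact: (integrableZl measurableT t (ih i)).
split.
  split; first by apply: measurable_funD; exact: measurable_funM.
  move=> i; have := integrableD measurableT (is_ i) (it_ i).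
  by congr (mu.-integrable _ _); apply/funext => z /=; congr EFin; ring.
apply/rowP => i; rewrite !mxE E RintegralD//.
by rewrite !RintegralZl//; [exact: ih|exact: ig].
Qed.

Lemma cn_convex_cone : convex_cone (cn mu phi).
Proof.
have G0 : G (cst 0).
  split=> // i; rewrite (_ : (fun _ => _) = cst 0%E); first exact: integrable0.
  by apply/funext => z; rewrite mulr0.
split.
- exists (cst 0); first by split.
  apply/rowP => i; rewrite !mxE (_ : (fun _ => _) = cst 0).
    by rewrite Rintegral_cst// mul0r.
  by apply/funext => z; rewrite mulr0.
- move=> _ _ [g [Gg g0] <-] [h [Gh h0] <-].
  have [Gl Ml] := moment_lin 1 1 Gg Gh.
  exists (fun z => 1 * g z + 1 * h z); last by rewrite Ml !scale1r.
  by split=> // z; rewrite !mul1r addr_ge0.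
- move=> t _ t0 [g [Gg g0] <-].
  have [Gl Ml] := moment_lin t 0 Gg G0.
  exists (fun z => t * g z + 0 * cst 0 z); last by rewrite Ml scale0r addr0.
  by split=> // z; rewrite mul0r addr0 mulr_ge0.
Qed.

Lemma class_Gpos_indic (g : Z -> R) (A : set Z) : measurable A -> Gpos g ->
  Gpos (fun z => g z * \1_A z).
Proof.
move=> mA [Gg g0]; split; last by move=> z; rewrite mulr_ge0.
apply: (class_G_dom Gg).
  by apply: measurable_funM => //; exact: Gg.1.
apply: aeW => z; rewrite normrM ler_piMr// indicE.
by case: (_ \in _); rewrite ?normr1// normr0.
Qed.

(** The moment of [g] is the sum of its moments over [A] and over the complement, both in the cone,
    so [face_split] applies. *)
Lemma face_moment_indic (F : set 'rV[R]_n) (g : Z -> R) (A : set Z) :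
  face (cn mu phi) F -> measurable A -> Gpos g -> F (moment mu phi g) ->
  F (moment mu phi (fun z => g z * \1_A z)).
Proof.
move=> faceF mA Gg Fg.
have mCA : measurable (~` A) by exact: measurableC.
have h1 := class_Gpos_indic mA Gg; have h2 := class_Gpos_indic mCA Gg.
apply: (face_split (y := moment mu phi (fun z => g z * \1_(~` A) z))
  cn_convex_cone faceF).
- by eexists; [exact: h1|].
- by eexists; [exact: h2|].
have [_] := moment_lin 1 1 h1.1 h2.1; rewrite !scale1r => <-.
suff -> : (fun z => 1 * (g z * \1_A z) + 1 * (g z * \1_(~` A) z)) = g by [].
apply/funext => z; rewrite !indicE in_setC.
by case: (_ \in _) => /=; ring.
Qed.

(* Countably many boxes of side [2 / (k + 1)], disjoint from [F] even after
   taking their closures, cover the complement of [closure F]. *)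
Definition box_center (b : nat * {ffun 'I_n -> int}) (i : 'I_n) : R :=
  (b.2 i)%:~R / b.1.+1%:R.

Definition box (b : nat * {ffun 'I_n -> int}) : set 'rV[R]_n :=
  [set x | forall i, `|x ord0 i - box_center b i| < b.1.+1%:R^-1].

Definition separated_box (F : set 'rV[R]_n) (b : nat * {ffun 'I_n -> int}) :=
  forall x, F x -> exists i, b.1.+1%:R^-1 < `|x ord0 i - box_center b i|.

Lemma not_closureP (F : set 'rV[R]_n) (x : 'rV[R]_n) :
  ~ closure F x <-> exists2 b, separated_box F b & box b x.
Proof.
split.
  move=> xF; have /existsNP[B /not_implyP[+ FB0]] :
    ~ forall B, nbhs x B -> F `&` B !=set0 by exact: xF.
  move=> /nbhs_ballP[e /= e0 eB].
  (* With a mesh [1 / (k + 1)] below [e / 2], rounding [x] down gives a grid point whose closed box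
     lies within distance [e] of [x], hence misses [F]. *)
  have [k _ /(_ k (leqnn k))/= ke] := near_infty_natSinv_lt (PosNum (divr_gt0 e0 (ltr0n R 2))).
  pose f := [ffun i => Num.floor (k.+1%:R * x ord0 i)].
  have k0 : 0 < k.+1%:R :> R by [].
  have boxx : box (k, f) x.
    move=> i; rewrite /box_center /= ffunE.
    have /andP[h1 h2] := floor_itv (k.+1%:R * x ord0 i).
    rewrite intrD1 in h2.
    set y := x ord0 i - _.
    have : `|k.+1%:R * y| < 1.
      have -> : k.+1%:R * y = k.+1%:R * x ord0 i - (Num.floor (k.+1%:R * x ord0 i))%:~R.
        by rewrite /y; field; rewrite gt_eqF.
      by rewrite ger0_norm ?subr_ge0// ltrBlDl.
    by rewrite normrM gtr0_norm// -ltr_pdivlMl// mulr1.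
  exists (k, f) => // y Fy; apply: contrapT => /forallNP h; apply: FB0; exists y.
  split=> //; apply: eB; split=> // i j; rewrite !ord1 -ball_normE/=.
  have := boxx j; have /negP := h j; rewrite -leNgt /= => h1 h2.
  have -> : x ord0 j - y ord0 j = (x ord0 j - box_center (k, f) j) -
     (y ord0 j - box_center (k, f) j) by ring.
  apply: (le_lt_trans (ler_normB _ _)).
  have ke2 : k.+1%:R^-1 < e / 2 := ke.
  apply: (le_lt_trans (lerD (ltW h2) h1)) => /=.
  by rewrite [ltRHS]splitr ltrD.
move=> [b sepb boxx] /(_ (box b)) h.
have : nbhs x (box b).
  rewrite /box.
  have : forall i : 'I_n, \forall y \near x, `|(y : 'rV[R]_n) ord0 i - box_center b i| < b.1.+1%:R^-1.
    move=> i.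
    have ci : (y : 'rV[R]_n) ord0 i @[y --> x] --> x ord0 i.
      exact: coord_continuous.
    have gap : 0 < b.1.+1%:R^-1 - `|x ord0 i - box_center b i|.
      by rewrite subr_gt0; exact: boxx.
    move/cvgrPdist_lt : ci => /(_ _ gap); apply: filterS => y hy.
    have -> : y ord0 i - box_center b i =
      (x ord0 i - box_center b i) - (x ord0 i - y ord0 i) by ring.
    by apply: (le_lt_trans (ler_normB _ _)); rewrite -ltrBrDl.
  by move=> /filter_forall.
move=> /h [y [Fy byy]]; have [i hi] := sepb y Fy.
by have := byy i; rewrite ltNge (ltW hi).
Qed.

Lemma measurable_box b : measurable (phi @^-1` box b).
Proof.
have -> : phi @^-1` box b = \bigcap_(i : 'I_n)
    ((fun z => `|phi z ord0 i - box_center b i|) @^-1` `]-oo, b.1.+1%:R^-1[).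
  apply/seteqP; split=> [z /= bz i _ /=|z /= bz i].
    by rewrite in_itv/=; exact: bz.
  by have := bz i I; rewrite /= in_itv.
apply: fin_bigcap_measurable => // i _.
have m1 : measurable_fun [set: Z] (fun z => `|phi z ord0 i - box_center b i|).
  by apply: measurableT_comp => //; exact: measurable_funB.
by rewrite -[X in measurable X]setTI; apply: m1.
Qed.

(** The complement is a countable union of preimages of boxes, which are measurable coordinate by
    coordinate. *)
Lemma measurable_closure_preimage (F : set 'rV[R]_n) :
  measurable (phi @^-1` closure F).
Proof.
rewrite -[X in measurable X]setCK; apply: measurableC.
have -> : ~` (phi @^-1` closure F) =
    \bigcup_b (if pselect (separated_box F b) then phi @^-1` box b else set0).
  apply/seteqP; split=> [z /not_closureP[b sb bz]|z [b _]].
    by exists b => //; case: pselect.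
  by case: pselect => // sb bz; apply/not_closureP; exists b.
apply: countable_bigcupT_measurable => [|b]; first exact: countableP.
by case: pselect => ?; [exact: measurable_box|exact: measurable0].
Qed.

End moments.

(** * Faces of the moment cone and supports of densities *)

Section face_supports.
Context d (Z : measurableType d) (R : realType) (n : nat).
Variables (mu : {measure set Z -> \bar R}) (phi : Z -> 'rV[R]_n).
Hypothesis mphi : forall i, measurable_fun [set: Z] (fun z => phi z ord0 i).

Local Notation G := (class_G mu phi).
Local Notation Gpos := (class_Gpos mu phi).
Local Notation integrableT f := (mu.-integrable [set: Z] (EFin \o f)).

(* The mean of [phi] over [phi @^-1` box b] with respect to [h] would lie both
   in [F] and in the closed box. *)
Lemma face_vanish_box (F : set 'rV[R]_n) (h : Z -> R) b :
  face (cn mu phi) F -> Gpos h -> F (moment mu phi h) ->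
  separated_box F b -> {ae mu, forall z, box b (phi z) -> h z = 0}.
Proof.
move=> faceF Gh Fh sepb.
have mA := measurable_box mphi b.
set A := phi @^-1` box b in mA.
have [F0 FD FZ] := face_convex_cone (cn_convex_cone mu phi) faceF.
pose h1 z := h z * \1_A z.
have [Gh1 h10] : Gpos h1 := class_Gpos_indic mphi mA Gh.
have Fh1 : F (moment mu phi h1) := face_moment_indic mphi faceF mA Gh Fh.
have inA z : h1 z != 0 -> box b (phi z).
  rewrite /h1 indicE; have [|_] := boolP (z \in A); last by rewrite mulr0 eqxx.
  by rewrite inE.
have ih1 : integrableT h1.
  (* Since 0 is in [F], the box keeps away from 0 in some coordinate [i]. There [|phi_i|] is at
     least [del > 0], so [h1] is dominated by [del^-1 |phi_i h1|]. *)
  have [i] := sepb 0 F0; rewrite mxE sub0r normrN => hi.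
  pose del := `|box_center R b i| - b.1.+1%:R^-1.
  have del0 : 0 < del by rewrite subr_gt0.
  have ig := integrableZl measurableT del^-1 (Gh1.2 i).
  apply: (ae_le_integrable Gh1.1 ig).
  apply: aeW => z /=; have [->|/inA /(_ i) hz] := eqVneq (h1 z) 0.
    by rewrite normr0.
  rewrite !normrM mulrA ler_peMl// normfV (gtr0_norm del0) ler_pdivlMl// mulr1.
  rewrite /del lerBlDr -{1}(subKr (phi z ord0 i) (box_center R b i)).
  by apply: (le_trans (ler_normB _ _)); rewrite lerD2l ltW.
pose m := \int[mu]_z h1 z.
have m0 : 0 <= m by apply: Rintegral_ge0.
have [mpos|] := ltP 0 m.
  exfalso; have mV0 : 0 <= m^-1 by rewrite invr_ge0.
  have [j] := sepb _ (FZ _ _ mV0 Fh1).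
  apply/negP; rewrite -leNgt.
  have iphi := Gh1.2 j.
  have ic := integrableZl measurableT (box_center R b j) ih1.
  have iB := integrableB measurableT iphi ic.
  have ih := integrableZl measurableT b.1.+1%:R^-1 ih1.
  have E : m * ((m^-1 *: moment mu phi h1) ord0 j - box_center R b j) =
      \int[mu]_z (phi z ord0 j * h1 z - box_center R b j * h1 z).
    rewrite RintegralB// RintegralZl// !mxE mulrBr mulrA mulfV ?gt_eqF// mul1r.
    by rewrite [m * _]mulrC.
  rewrite -(ler_pM2l mpos) -{1}(gtr0_norm mpos) -normrM E.
  apply: (le_trans (le_normr_Rintegral _ _)) => //.
  rewrite [leRHS]mulrC -RintegralZl//.
  apply: le_Rintegral => //; first exact: (integrable_norm iB).
  move=> z _; rewrite -mulrBl normrM (ger0_norm (h10 z)).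
  have [->|/inA /(_ j) hz] := eqVneq (h1 z) 0; first by rewrite !mulr0.
  by rewrite ler_wpM2r// ltW.
move=> m_le0.
have i0 : integrableT (cst 0 : Z -> R) by exact: integrable0.
have : {ae mu, forall z, cst 0 z = h1 z}.
  apply: (ae_eq_of_le_integral i0 ih1); first exact: aeW.
  by rewrite Rintegral_cst// mul0r.
by apply: filterS => z /= hz bz; rewrite hz /h1 indicE mem_set// mulr1.
Qed.

Lemma face_vanish (F : set 'rV[R]_n) (h : Z -> R) :
  face (cn mu phi) F -> Gpos h -> F (moment mu phi h) ->
  {ae mu, forall z, ~ closure F (phi z) -> h z = 0}.
Proof.
move=> faceF Gh Fh.
have : {ae mu, forall z, forall k, if unpickle k is Some b then
    separated_box F b -> box b (phi z) -> h z = 0 else True}.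
  apply/ae_foralln => k; case: (unpickle k) => [b|]; last exact: aeW.
  have [sb|nsb] := pselect (separated_box F b); last exact: aeW.
  by apply: filterS (face_vanish_box faceF Gh Fh sb) => z hz _.
apply: filterS => z H /not_closureP[b sb bz].
by have := H (pickle b); rewrite pickleK; apply.
Qed.

(** Fixed points of a linear map form a closed set. With [P] the projection onto the span of [F],
    this keeps [closure F] inside that span. *)
Lemma closure_fixed (F : set 'rV[R]_n) (P : 'M[R]_n) :
  (forall x, F x -> x *m P = x) -> forall x, closure F x -> x *m P = x.
Proof.
move=> FP x Fx; apply/rowP => j; apply/eqP; rewrite eq_le.
pose c := (\col_i P i j)^T - delta_mx ord0 j : 'rV[R]_n.
have E y : (y *m P) ord0 j - y ord0 j = inner c y.
  rewrite mxE /inner.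
  have -> : y ord0 j = \sum_i (i == j)%:R * y ord0 i.
    rewrite (bigD1 j)//= eqxx mul1r big1 ?addr0// => i /negPf ->.
    by rewrite mul0r.
  rewrite -sumrB; apply: eq_bigr => i _; rewrite !mxE eqxx/=; ring.
have cE : inner c x = 0.
  apply/eqP; rewrite -normr_le0; apply/ler_addgt0Pr => e e0; rewrite add0r.
  pose S := \sum_i `|c ord0 i| + 1.
  have S0 : 0 < S by rewrite ltr_wpDl// sumr_ge0.
  have [y [Fy [_ xy]]] := Fx _ (nbhsx_ballx x (e / S) (divr_gt0 e0 S0)).
  have -> : inner c x = inner c (x - y).
    by rewrite innerBr -(E y) FP// subrr subr0.
  apply: (le_trans (ler_norm_sum _ _ _)).
  apply: (@le_trans _ _ (\sum_i `|c ord0 i| * (e / S))).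
    apply: ler_sum => i _; rewrite normrM ler_wpM2l// !mxE ltW//.
    exact: xy.
  rewrite -mulr_suml mulrCA -ler_pdivlMl// mulVf ?gt_eqF//.
  by rewrite ler_pdivrMr// mul1r /S lerDl.
by have := E x; rewrite cE => /subr0_eq ->; rewrite lexx.
Qed.

(** Converse of [face_vanish]. The moment lies in the span of [F] because [phi] does wherever [g] is
    nonzero; hence some [t u - moment] lies in [F], and the moment is a summand of [t u], an element
    of [F]. *)
Lemma face_moment (F : set 'rV[R]_n) (g : Z -> R) :
  face (cn mu phi) F -> Gpos g ->
  {ae mu, forall z, ~ closure F (phi z) -> g z = 0} -> F (moment mu phi g).
Proof.
move=> faceF Gg g0.
have coneF := face_convex_cone (cn_convex_cone mu phi) faceF.
have [F0 FD FZ] := coneF.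
have [u [P [Fu PF core]]] := convex_cone_core coneF.
have mP : moment mu phi g *m P = moment mu phi g.
  apply/rowP => j; pose c : 'rV[R]_n := \row_i P i j.
  have [i1 <-] : integrableT (fun z => inner c (phi z) * g z) /\
      \int[mu]_z (inner c (phi z) * g z) = (moment mu phi g *m P) ord0 j.
    have [h1 ->] := inner_moment c Gg.1; split=> //.
    by rewrite mxE /inner; apply: eq_bigr => i _; rewrite !mxE mulrC.
  rewrite mxE /Rintegral; congr fine; apply: ae_eq_integral => //.
  - exact: measurable_int i1.
  - exact: measurable_int (Gg.1.2 j).
  apply: filterS g0 => z gz _ /=.
  have [Fz|/gz ->] := pselect (closure F (phi z)); last by rewrite !mulr0.
  congr (_ * _)%:E; rewrite -{2}(closure_fixed PF Fz) mxE /inner.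
  by apply: eq_bigr => i _; rewrite mxE mulrC.
have [t t0] := core (moment mu phi g); rewrite mP => tF.
have cM : cn mu phi (moment mu phi g) by exists g.
apply: (face_split (y := t *: u - moment mu phi g) (cn_convex_cone mu phi) faceF) => //.
  by case: faceF => _ _ FC _; exact: FC.
by rewrite addrC subrK; exact: FZ.
Qed.

End face_supports.

(** * Optimality *)

Section primal_solutions.
Context d (Z : measurableType d) (R : realType) (n : nat).
Variables (mu : {measure set Z -> \bar R}) (phi : Z -> 'rV[R]_n).
Hypothesis mphi : forall i, measurable_fun [set: Z] (fun z => phi z ord0 i).
Variable beta : Z -> R -> \bar R.
Hypothesis Bbeta : class_B beta.
Variable a : 'rV[R]_n.
Hypothesis Jfin : J_ mu phi beta a \is a fin_num.

Local Notation integrableT f := (mu.-integrable [set: Z] (EFin \o f)).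
Local Notation Gapos := (class_Gapos mu phi a).
Local Notation H := (H_ mu beta).
Local Notation J := (J_ mu phi beta a).

Lemma integrable_fine_comp (f : Z -> \bar R) : mu.-integrable [set: Z] f ->
  [/\ integrableT (fine \o f), {ae mu, forall z, f z = (fine (f z))%:E} &
      (\int[mu]_z fine (f z))%:E = (\int[mu]_z f z)%E].
Proof.
move=> fi; have mf := measurable_int _ fi.
have ff : {ae mu, forall z, f z = (fine (f z))%:E}.
  by apply: filterS (integrable_ae measurableT fi) => z /(_ I) fz; rewrite fineK.
have mff : measurable_fun [set: Z] (EFin \o (fine \o f)).
  by apply/measurable_EFinP; exact: measurableT_comp.
have E : (\int[mu]_z (fine (f z))%:E = \int[mu]_z f z)%E.
  apply: ae_eq_integral; [exact: measurableT|exact: mff|exact: mf|].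
  by apply: filterS ff => z ffz _; rewrite -ffz.
have I1 : integrableT (fine \o f).
  apply/integrableP; split=> //.
  rewrite (@ae_eq_integral _ _ _ mu setT (abse \o f))//.
  - by have /integrableP[] := fi.
  - exact: measurableT_comp.
  - exact: measurableT_comp.
  - by apply: filterS ff => z ffz _ /=; rewrite [in RHS]ffz.
split=> //; rewrite /Rintegral E fineK//; exact: integrable_fin_num.
Qed.

Lemma J_le h : Gapos h -> (J <= H h)%E.
Proof. by move=> Gh; apply: ereal_inf_lbound; exists h. Qed.

Lemma measurable_beta h : Gapos h ->
  measurable_fun [set: Z] (fun z => beta z (h z)).
Proof. by move=> [[[mh _] _] h0]; exact: measurable_integrand. Qed.

Lemma H_integrable h : Gapos h -> (H h < +oo)%E ->
  mu.-integrable [set: Z] (fun z => beta z (h z)) /\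
  H h = (\int[mu]_z beta z (h z))%E.
Proof.
move=> Gh Hlt; apply: pintegral_fin => //; first exact: measurable_beta.
rewrite -/(H h) fin_numElt Hlt andbT.
by apply: lt_le_trans (J_le Gh); rewrite ltNye; move: Jfin; rewrite fin_numE => /andP[].
Qed.

Lemma primal_J g : primal_solution mu phi beta a g -> H g = J.
Proof.
move=> [Gg gmin]; apply/eqP; rewrite eq_le J_le// andbT.
by apply: le_ereal_inf_tmp => _ [h Gh <-]; exact: gmin.
Qed.

Lemma primal_integrable g : primal_solution mu phi beta a g ->
  mu.-integrable [set: Z] (fun z => beta z (g z)) /\
  (\int[mu]_z beta z (g z))%E = J.
Proof.
move=> pg; have HJ := primal_J pg.
have [] := H_integrable pg.1; last by rewrite HJ => ? ->.
by rewrite HJ ltey; move: Jfin; rewrite fin_numE => /andP[].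
Qed.

Lemma primal_ae g g' : primal_solution mu phi beta a g -> Gapos g' ->
  g' = g %[ae mu] -> primal_solution mu phi beta a g'.
Proof.
move=> pg Gg' gg'; split=> // h Gh.
have [ig IJ] := primal_integrable pg.
apply: le_trans (J_le Gh); rewrite -IJ; apply: pintegral_le => //.
  exact: measurable_beta.
by apply: filterS gg' => z /= /(_ I) -> _.
Qed.

Lemma Gapos_ae g h : class_Ga mu phi a g -> measurable_fun [set: Z] h ->
  h = g %[ae mu] -> (forall z, 0 <= h z) -> Gapos h.
Proof.
move=> [Gg mg] mh hg h0.
have Gh : class_G mu phi h.
  by apply: (class_G_dom mphi Gg mh); apply: filterS hg => z /= /(_ I) ->.
by split=> //; split=> //; rewrite /= -mg; exact: moment_ae Gh Gg hg.
Qed.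

(** The midpoint [m] of two minimizers is admissible and [beta z (m z)] is at most the average [w],
    whose integral is [J]. Minimality forces equality almost everywhere, and strict convexity then
    forces [g1 = g2]. *)
Lemma primal_unique g1 g2 : primal_solution mu phi beta a g1 ->
  primal_solution mu phi beta a g2 -> g1 = g2 %[ae mu].
Proof.
move=> p1 p2; have [i1 I1] := primal_integrable p1.
have [i2 I2] := primal_integrable p2.
have [[[G1 m1] pos1] _] := p1; have [[[G2 m2] pos2] _] := p2.
have [if1 f1 E1] := integrable_fine_comp i1.
have [if2 f2 E2] := integrable_fine_comp i2.
pose m z := 2^-1 * g1 z + 2^-1 * g2 z.
have [Gm mm] := moment_lin 2^-1 2^-1 G1 G2.
have Gam : Gapos m.
  split; last by move=> z; rewrite addr_ge0// mulr_ge0.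
  split=> //; rewrite /= mm m1 m2 -scalerDl (_ : 2^-1 + 2^-1 = 1 :> R) ?scale1r//.
  by lra.
pose w z := 2^-1 * fine (beta z (g1 z)) + 2^-1 * fine (beta z (g2 z)).
have iz1 := integrableZl measurableT 2^-1 if1.
have iz2 := integrableZl measurableT 2^-1 if2.
have iw : integrableT w := integrableD measurableT iz1 iz2.
have Iw : \int[mu]_z w z = fine J.
  rewrite /w RintegralD// !RintegralZl//.
  have -> : \int[mu]_z fine (beta z (g1 z)) = fine J by rewrite -I1 -E1.
  have -> : \int[mu]_z fine (beta z (g2 z)) = fine J by rewrite -I2 -E2.
  by lra.
have half0 : 0 <= 2^-1 :> R by lra.
have half1 : 2^-1 <= 1 :> R by lra.
have le_w : {ae mu, forall z, (beta z (m z) <= (w z)%:E)%E}.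
  apply: filterS2 f1 f2 => z b1 b2.
  have := @Gamma_convex _ _ (Bbeta.2 z) (g1 z) (g2 z) (fine (beta z (g1 z)))
    (fine (beta z (g2 z))) 2^-1 half0 half1.
  rewrite (_ : 1 - 2^-1 = 2^-1 :> R); last by lra.
  by rewrite -b1 -b2 => /(_ (lexx _) (lexx _)).
have Hm : (H m <= J)%E.
  have EJ : (\int[mu]_z (w z)%:E)%E = J.
    by rewrite -(fineK Jfin) -Iw /Rintegral fineK//; exact: integrable_fin_num.
  rewrite -EJ; apply: pintegral_le => //; first exact: measurable_beta.
  by apply: filterS le_w.
have [im Im] : mu.-integrable [set: Z] (fun z => beta z (m z)) /\
    H m = (\int[mu]_z beta z (m z))%E.
  apply: H_integrable => //; apply: le_lt_trans Hm _.
  by rewrite ltey; move: Jfin; rewrite fin_numE => /andP[].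
have [ifm fm Em] := integrable_fine_comp im.
have : {ae mu, forall z, fine (beta z (m z)) = w z}.
  apply: (ae_eq_of_le_integral ifm iw).
    by apply: filterS2 le_w fm => z + bm; rewrite bm lee_fin.
  by rewrite Iw -lee_fin Em (fineK Jfin) -Im J_le.
move=> eqw.
have : {ae mu, forall z, g1 z = g2 z}.
  apply: filterS3 eqw f1 f2 => z zw b1 b2.
  apply: contrapT => /eqP g12.
  have fb1 : beta z (g1 z) \is a fin_num by rewrite b1.
  have fb2 : beta z (g2 z) \is a fin_num by rewrite b2.
  have := Gamma_midpoint (Bbeta.2 z) fb1 fb2 g12.
  have -> : (g1 z + g2 z) / 2 = m z by rewrite /m; field.
  rewrite zw /w; lra.
by apply: filterS => z ->.
Qed.

Lemma exn_primal g f : class_Ga mu phi a g -> exn mu phi beta f ->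
  g = f %[ae mu] ->
  exists2 g', primal_solution mu phi beta a g' & g' = g %[ae mu].
Proof.
move=> Gg [F faceF [th [_ near] fE]] gf.
have sub : {ae mu, forall z, 0 <= g z /\
    if `[< closure F (phi z) >] then
      subgradient (beta z) (inner th (phi z)) (g z) else g z = 0}.
  apply: filterS2 near gf => z fnear /= /(_ I) ->; rewrite -fE /f_.
  case: (asboolP (closure F (phi z))) => [clF|nclF]; last first.
    by rewrite asboolF; [split|move=> [/nclF]].
  (* Finiteness near the slope yields a point [t0] with this subgradient; the derivative in [f_]
     then exists and equals [t0]. *)
  have [t0 sg] := finite_near_subgradient (Bbeta.2 z) (fnear clF).
  have [ed edE] := conjugate_derive (Bbeta.2 z) sg.
  rewrite (asboolT (conj clF ed)) edE; split=> //.
  exact: (Gamma_dom (Bbeta.2 z) sg.1).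
(* Admissibility asks for nonnegativity at every point, while the subgradient condition gives it
   only almost everywhere. *)
pose g' z := Num.max 0 (g z).
have gg' : g' = g %[ae mu].
  by apply: filterS sub => z [g0 _] _; rewrite /g' max_r.
have mg' : measurable_fun [set: Z] g'.
  by apply: measurable_maxr => //; exact: Gg.1.1.
have Gg' : Gapos g'.
  by apply: Gapos_ae Gg mg' gg' _ => z; rewrite le_max lexx.
exists g' => //; split=> // h Gh.
have [->|Hh] := eqVneq (H h) +oo%E; first exact: leey.
have Hlt : (H h < +oo)%E by rewrite ltey.
have [ih ->] := H_integrable Gh Hlt.
have Fa : F a.
  have <- : moment mu phi g' = a := Gg'.1.2.
  have Gp' : class_Gpos mu phi g' by split; [exact: Gg'.1.1|exact: Gg'.2].
  apply: (face_moment faceF Gp').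
  apply: filterS2 sub gg' => z [_ sz] /= /(_ I) -> nclF.
  by move: sz; rewrite asboolF.
have h_vanish := face_vanish mphi faceF (conj Gh.1.1 Gh.2 : class_Gpos mu phi h).
have mh : moment mu phi h = a := Gh.1.2.
have mg : moment mu phi g' = a := Gg'.1.2.
have [Gd Md] := moment_lin 1 (-1) Gg'.1.1 Gh.1.1.
have [id Id] := inner_moment th Gd.
have Id0 : (\int[mu]_z (inner th (phi z) * (1 * g' z + -1 * h z))%:E = 0)%E.
  rewrite -(fineK (integrable_fin_num measurableT id)); congr EFin.
  rewrite [LHS]Id Md mg mh scale1r scaleN1r subrr.
  by rewrite /inner big1// => i _; rewrite mxE mulr0.
(* As [g'] and [h] have the same moment, the linear term integrates to 0 and may be added. *)
have -> : (\int[mu]_z beta z (h z) = \int[mu]_z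
    (beta z (h z) + (inner th (phi z) * (1 * g' z + -1 * h z))%:E))%E.
  by rewrite integralD// Id0 adde0.
apply: pintegral_le => //.
- exact: measurable_beta.
- exact: integrableD.
have := h_vanish; rewrite mh => /(_ Fa) hv.
apply: filterS3 sub gg' hv => z [g0 sz] /= /(_ I) -> hz _.
move: sz; case: asboolP => clF => [sg|gz].
  have := sg.2 (h z); have [gfin|] := boolP (beta z (h z) \is a fin_num).
    rewrite -(fineK gfin) -(fineK sg.1) -!EFinD !lee_fin; lra.
  by move=> /(Gamma_pinfty (Bbeta.2 z)) -> _; rewrite addye// leey.
by rewrite gz hz// !mulr0 addr0 mulr0 adde0.
Qed.

End primal_solutions.

Lemma inner_row_mx (R : realType) (m n : nat) (u : 'rV[R]_(m + n)) (x : 'rV[R]_m)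
    (y : 'rV[R]_n) :
  inner u (row_mx x y) = inner (lsubmx u) x + inner (rsubmx u) y.
Proof.
rewrite /inner big_split_ord /=; congr (_ + _); apply: eq_bigr => i _.
  by rewrite row_mxEl mxE.
by rewrite row_mxEr mxE.
Qed.

Lemma inner_scalar_mx (R : realType) (u : 'rV[R]_1) (y : R) :
  inner u y%:M = u ord0 ord0 * y.
Proof. by rewrite /inner big_ord1 mxE eqxx mulr1n. Qed.

(** The inequalities at positive rationals bound the conjugate at [r] through [conjugate_rat], and
    this bound contains the inequality at every [t]. *)
Lemma subgradient_rat (R : realType) (gamma : R -> \bar R) (r t0 : R) :
  class_Gamma gamma -> gamma t0 \is a fin_num ->
  (forall q : rat, 0 < q ->
    fine (gamma t0) + r * (ratr q - t0) <= fine (gamma (ratr q))) ->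
  subgradient gamma r t0.
Proof.
move=> Gg g0 Hq; apply: subgradientP => // t gt.
have cle : (conjugate gamma r <= (r * t0 - fine (gamma t0))%:E)%E.
  rewrite conjugate_rat//; apply: ge_ereal_sup => _ [q /= q0 <-].
  rewrite (Gamma_fin Gg); last by rewrite ltr0q.
  by rewrite -EFinB lee_fin; have := Hq q q0; lra.
have : ((r * t)%:E - gamma t <= (r * t0 - fine (gamma t0))%:E)%E.
  by apply: le_trans cle; apply: ereal_sup_ubound; exists t.
by rewrite -(fineK gt) -EFinB lee_fin -[fine (fine _)%:E]/(fine (gamma t)); lra.
Qed.

(** * A separating functional at a primal solution and its pointwise form *)

Section dual_attainment.
Context d (Z : measurableType d) (R : realType) (n : nat).
Variables (mu : {sigma_finite_measure set Z -> \bar R}) (phi : Z -> 'rV[R]_n).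
Hypothesis mphi : forall i, measurable_fun [set: Z] (fun z => phi z ord0 i).
Variable beta : Z -> R -> \bar R.
Hypothesis Bbeta : class_B beta.
Variable a : 'rV[R]_n.
Hypothesis Jfin : J_ mu phi beta a \is a fin_num.
Variable F : set 'rV[R]_n.
Hypothesis faceF : face (cn mu phi) F.
Hypothesis Fa : F a.
Hypothesis F_core : forall x, F x -> exists2 t : R, 0 < t & F (a - t *: x).
Variable g : Z -> R.
Hypothesis pg : primal_solution mu phi beta a g.
Hypothesis g_supp : forall z, ~ closure F (phi z) -> g z = 0.

Local Notation integrableT f := (mu.-integrable [set: Z] (EFin \o f)).
Local Notation H := (H_ mu beta).

Let w0 z := fine (beta z (g z)).

(* [w] is a real integrable majorant of [beta z (h z)]; working with majorants
   keeps the epigraph of [H] within finite values. *)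
Definition competitor (h w : Z -> R) : Prop :=
  [/\ class_Gpos mu phi h, forall z, ~ closure F (phi z) -> h z = 0,
      integrableT w & {ae mu, forall z, (beta z (h z) <= (w z)%:E)%E}].

Let beta_g : {ae mu, forall z, beta z (g z) = (w0 z)%:E}.
Proof.
have [ig _] := primal_integrable Bbeta Jfin pg.
by have [_ + _] := integrable_fine_comp ig.
Qed.

Let Gg : class_G mu phi g. Proof. by case: pg => [[[]]]. Qed.
Let mg : moment mu phi g = a. Proof. by case: pg => [[[]]]. Qed.
Let g0 z : 0 <= g z. Proof. by case: pg => [[_ +] _]; exact. Qed.

Let iw0 : integrableT w0.
Proof.
have [ig _] := primal_integrable Bbeta Jfin pg.
by have [+ _ _] := integrable_fine_comp ig.
Qed.

Let Iw0 : (\int[mu]_z w0 z)%:E = H g.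
Proof.
have [ig IJ] := primal_integrable Bbeta Jfin pg.
have [_ _ ->] := integrable_fine_comp ig.
by rewrite IJ (primal_J pg).
Qed.

Lemma competitor_self : competitor g w0.
Proof.
split=> //; apply: filterS beta_g => z ->; exact: lexx.
Qed.

Lemma competitor_convex (s t : R) h1 w1 h2 w2 : 0 <= s -> 0 <= t -> s + t = 1 ->
  competitor h1 w1 -> competitor h2 w2 ->
  competitor (fun z => s * h1 z + t * h2 z) (fun z => s * w1 z + t * w2 z).
Proof.
move=> s0 t0 st [[G1 p1] supp1 i1 l1] [[G2 p2] supp2 i2 l2]; split.
- split; first exact: (moment_lin s t G1 G2).1.
  by move=> z /=; rewrite addr_ge0// mulr_ge0.
- by move=> z nF; rewrite supp1// supp2// !mulr0 addr0.
- have j1 := integrableZl measurableT s i1.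
  have j2 := integrableZl measurableT t i2.
  exact: (integrableD measurableT j1 j2).
have t1 : t <= 1 by lra.
have -> : s = 1 - t by lra.
by apply: filterS2 l1 l2 => z; exact: (Gamma_convex (Bbeta.2 z) t0 t1).
Qed.

Lemma competitor_moment h w : competitor h w -> F (moment mu phi h).
Proof.
move=> [Gh hs _ _]; apply: (face_moment faceF Gh); exact: aeW.
Qed.

Lemma competitor_primal h w : competitor h w -> moment mu phi h = a ->
  \int[mu]_z w0 z <= \int[mu]_z w z.
Proof.
move=> [[Gh h0] _ iw lw] mh; have Gah : class_Gapos mu phi a h by split.
have -> : \int[mu]_z w z = fine (\int[mu]_z (w z)%:E) by [].
rewrite -lee_fin Iw0 fineK; last exact: integrable_fin_num.
apply: le_trans (pg.2 _ Gah) _; apply: pintegral_le => //.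
  exact: (measurable_beta Bbeta Gah).
by apply: filterS lw.
Qed.

(** The cone generated by the epigraph of the value function, translated to the optimal point; the
    slack [s] makes it closed upwards in the last coordinate. *)
Let epi_cone : set 'rV[R]_(n + 1) :=
  [set v | exists l s h w, [/\ 0 <= l, 0 <= s, competitor h w &
    v = row_mx (l *: (moment mu phi h - a))
          (l * (\int[mu]_z w z - \int[mu]_z w0 z) + s)%:M]].

Let epi_cone_convex : convex_cone epi_cone.
Proof.
split.
- exists 0, 0, g, w0; split=> //; first exact: competitor_self.
  by rewrite scale0r mul0r addr0 raddf0 row_mx0.
- move=> _ _ [l1 [s1 [h1 [w1 [l10 s10 c1 ->]]]]] [l2 [s2 [h2 [w2 [l20 s20 c2 ->]]]]].
  rewrite add_row_mx -raddfD.
  (* If both weights vanish only the slacks add up; otherwise the two competitors are averaged with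
     normalized weights. *)
  have := addr_ge0 l10 l20; rewrite le_eqVlt => /predU1P[l0|lpos].
    have -> : l1 = 0 by lra. have -> : l2 = 0 by lra.
    exists 0, (s1 + s2), h1, w1; split=> //; first exact: addr_ge0.
    by rewrite !scale0r !mul0r addr0 !add0r.
  have q1 : 0 <= l1 / (l1 + l2) by rewrite divr_ge0// ltW.
  have q2 : 0 <= l2 / (l1 + l2) by rewrite divr_ge0// ltW.
  have q12 : l1 / (l1 + l2) + l2 / (l1 + l2) = 1 by field; rewrite gt_eqF.
  exists (l1 + l2), (s1 + s2), (fun z => l1 / (l1 + l2) * h1 z + l2 / (l1 + l2) * h2 z),
    (fun z => l1 / (l1 + l2) * w1 z + l2 / (l1 + l2) * w2 z); split=> //.
  + exact: ltW.
  + exact: addr_ge0.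
  + exact: competitor_convex.
  case: c1 c2 => [[G1 _] _ i1 _] [[G2 _] _ i2 _].
  have j1 := integrableZl measurableT (l1 / (l1 + l2)) i1.
  have j2 := integrableZl measurableT (l2 / (l1 + l2)) i2.
  rewrite (moment_lin _ _ G1 G2).2 RintegralD// !RintegralZl//.
  congr row_mx; last by congr (_%:M); field; rewrite gt_eqF.
  by apply/rowP => i; rewrite !mxE; field; rewrite gt_eqF.
- move=> t _ t0 [l [s [h [w [l0 s0 c ->]]]]].
  exists (t * l), (t * s), h, w; split=> //; [exact: mulr_ge0|exact: mulr_ge0|].
  rewrite scale_row_mx scalerA; congr row_mx.
  by rewrite scale_scalar_mx mulrDr mulrA.
Qed.

(** The vector [(0, 1)] is in the cone and [(0, -1)] is not, for it would give a competitor of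
    moment [a] with a smaller integral. Membership of [(0, 1)] gives the sign of [tau]. If
    [tau = 0], the functional can be nonzero on the cone only through [A] on [F], where [a] and all
    competing moments lie. *)
Lemma competitor_separation : exists A (tau : R), [/\ 0 <= tau,
  forall h w, competitor h w ->
    0 <= inner A (moment mu phi h - a) +
         tau * (\int[mu]_z w z - \int[mu]_z w0 z) &
  tau = 0 -> exists2 x, F x & inner A x != 0].
Proof.
pose v : 'rV[R]_(n + 1) := row_mx 0 1%:M.
have vE : epi_cone v.
  exists 0, 1, g, w0; split=> //; first exact: competitor_self.
  by rewrite scale0r mul0r add0r.
have NvE : ~ epi_cone (- v).
  move=> [l [s [h [w [l0 s0 c]]]]]; rewrite /v opp_row_mx oppr0 => /eq_row_mx[mE iE].
  have {}iE : - 1 = l * (\int[mu]_z w z - \int[mu]_z w0 z) + s.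
    by move/matrixP : iE => /(_ ord0 ord0); rewrite !mxE eqxx !mulr1n.
  have [l00|lN0] := eqVneq l 0; first by rewrite l00 mul0r in iE; lra.
  have lpos : 0 < l by rewrite lt_neqAle eq_sym lN0.
  have mh : moment mu phi h = a.
    apply/subr0_eq; rewrite -[LHS]scale1r -(mulVf lN0) -scalerA -mE scaler0.
    by [].
  have := competitor_primal c mh; rewrite -subr_ge0 => h1.
  by have := mulr_ge0 l0 h1; lra.
have [th [th0 [u [l [s [h [w [l0 s0 c ->]]]]] upos]]] :=
  convex_cone_separation epi_cone_convex vE NvE.
have E x (y : R) : inner th (row_mx x y%:M) =
    inner (lsubmx th) x + rsubmx th ord0 ord0 * y.
  by rewrite inner_row_mx inner_scalar_mx.
exists (lsubmx th), (rsubmx th ord0 ord0); split.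
- have := th0 _ vE; rewrite E /inner big1 ?add0r ?mulr1// => i _.
  by rewrite [X in _ * X]mxE mulr0.
- move=> h' w' c'; have := th0 (row_mx (1 *: (moment mu phi h' - a))
    (1 * (\int[mu]_z w' z - \int[mu]_z w0 z) + 0)%:M).
  rewrite E scale1r mul1r addr0; apply.
  by exists 1, 0, h', w'; split=> //; rewrite scale1r mul1r addr0.
move=> tau0; apply: contrapT => noF.
have zeroF x : F x -> inner (lsubmx th) x = 0.
  by move=> Fx; apply: contrapT => /eqP xN0; apply: noF; exists x.
move: upos; rewrite E tau0 mul0r addr0 innerZr innerBr zeroF.
  by rewrite (zeroF a)// subrr mulr0 ltxx.
exact: competitor_moment c.
Qed.

Section pointwise.
Variables (A : 'rV[R]_n) (tau : R).
Hypothesis separation : forall h w, competitor h w ->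
    0 <= inner A (moment mu phi h - a) +
         tau * (\int[mu]_z w z - \int[mu]_z w0 z).

(** The integrand of the separation inequality at a point where [g] is replaced by the constant
    [t]. *)
Let L (t : R) z := inner A (phi z) * (t - g z) + tau * (fine (beta z t) - w0 z).

(* Test the separation inequality against [g] modified to the constant [t] on a
   set [N] where [L t] is negative. *)
Let pointwise_null (t : R) (N : set Z) (k : R) : 0 < t -> measurable N ->
  (mu N < +oo)%E -> (forall z, N z -> [/\ closure F (phi z), L t z < 0,
    forall i, `|phi z ord0 i| <= k & `|fine (beta z t)| <= k]) ->
  {ae mu, forall z, ~ N z}.
Proof.
move=> t0 mN Nfin HN.
have mNC := measurableC mN.
have iN : integrableT (\1_N : Z -> R).
  apply/integrableP; split; first exact/measurable_EFinP/measurable_indic.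
  rewrite (_ : (fun z => _) = (fun z => (\1_N z)%:E)).
    by rewrite integral_indic// setIT.
  by apply/funext => z /=; rewrite ger0_norm.
(* This multiple of the indicator of a set of finite measure dominates both the coordinates of [phi]
   and [beta z t] on [N]. *)
have ikN := integrableZl measurableT k iN.
have fb_meas : measurable_fun [set: Z] (fun z => fine (beta z t)).
  by apply: measurableT_comp => //; exact: Bbeta.1.
have GN : class_G mu phi (\1_N).
  split; first exact: measurable_indic.
  move=> i; apply: (ae_le_integrable _ ikN).
    by apply: measurable_funM => //; exact: measurable_indic.
  apply: aeW => z; rewrite indicE; have [|_] := boolP (z \in N).
    by rewrite inE => /HN[_ _ /(_ i) hk _]; rewrite !mulr1 (le_trans hk)// ler_norm.
  by rewrite !mulr0.
have [GgN gN0] := class_Gpos_indic mphi mNC (conj Gg g0 : class_Gpos mu phi g).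
have [Gh Mh] := moment_lin 1 t GgN GN.
set h := (X in class_G mu phi X) in Gh.
have hN z : N z -> h z = t.
  by move=> Nz; rewrite /h !indicE in_setC mem_set//= mulr0 mulr0 add0r mulr1.
have hNC z : ~ N z -> h z = g z.
  by move=> Nz; rewrite /h !indicE in_setC memNset//= !mulr1 mul1r mulr0 addr0.
pose w z := w0 z * \1_(~` N) z + fine (beta z t) * \1_N z.
have wN z : N z -> w z = fine (beta z t).
  by move=> Nz; rewrite /w !indicE in_setC mem_set//= mulr0 add0r mulr1.
have wNC z : ~ N z -> w z = w0 z.
  by move=> Nz; rewrite /w !indicE in_setC memNset//= mulr1 mulr0 addr0.
have mw0 : measurable_fun [set: Z] w0.
  by apply/measurable_EFinP; exact: measurable_int iw0.
have iw : integrableT w.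
  have j1 : integrableT (fun z => w0 z * \1_(~` N) z).
    apply: (ae_le_integrable _ iw0).
      by apply: measurable_funM => //; exact: measurable_indic.
    apply: aeW => z; rewrite normrM ler_piMr// indicE.
    by case: (_ \in _); rewrite ?normr1// normr0.
  have j2 : integrableT (fun z => fine (beta z t) * \1_N z).
    apply: (ae_le_integrable _ ikN).
      by apply: measurable_funM => //; exact: measurable_indic.
    apply: aeW => z; rewrite indicE; have [|_] := boolP (z \in N).
      by rewrite inE => /HN[_ _ _ hk]; rewrite !mulr1 (le_trans hk)// ler_norm.
    by rewrite !mulr0.
  exact: (integrableD measurableT j1 j2).
have chw : competitor h w.
  split=> //.
  - split=> // z /=; have [/hN ->|/hNC ->] := pselect (N z) => //; exact: ltW.
  - move=> z nF; rewrite hNC; first exact: g_supp.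
    by move=> /HN[].
  apply: filterS beta_g => z bg.
  have [Nz|Nz] := pselect (N z); last by rewrite hNC// wNC// bg.
  by rewrite hN// wN// (Gamma_fin (Bbeta.2 z) t0).
have [Gd Md] := moment_lin 1 (-1) Gh Gg.
have [id Id] := inner_moment A Gd.
have iB := integrableB measurableT iw iw0.
have itB := integrableZl measurableT tau iB.
(* This equals [L t], which is negative, on [N] and 0 elsewhere, but its integral is nonnegative by
   separation; hence [N] is null. *)
pose f z := inner A (phi z) * (1 * h z + -1 * g z) + tau * (w z - w0 z).
have jf : integrableT f := integrableD measurableT id itB.
have If : 0 <= \int[mu]_z f z.
  rewrite /f RintegralD// Id RintegralZl// RintegralB// Md mg scale1r scaleN1r.
  exact: separation.
have fN z : N z -> f z = L t z.
  by move=> Nz; rewrite /f /L hN// wN//; ring.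
have fNC z : ~ N z -> f z = 0.
  by move=> Nz; rewrite /f hNC// wNC//; ring.
have i0 : integrableT (cst 0 : Z -> R) by exact: integrable0.
have : {ae mu, forall z, f z = cst 0 z}.
  apply: (ae_eq_of_le_integral jf i0).
    apply: aeW => z /=; have [Nz|/fNC -> //] := pselect (N z).
    by rewrite fN//; have [_ /ltW] := HN z Nz.
  by rewrite Rintegral_cst// mul0r.
apply: filterS => z /= fz Nz; have [_ + _ _] := HN z Nz.
by rewrite -fN// fz ltxx.
Qed.

(** The set where the inequality fails is exhausted by countably many sets [N k j] on which
    everything is bounded by [k] and which lie in a set [E j] of finite measure. *)
Lemma pointwise_inequality (t : R) : 0 < t ->
  {ae mu, forall z, closure F (phi z) -> 0 <= L t z}.
Proof.
move=> t0.
have [E ET Efin] := sigma_finiteT mu.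
have mS := measurable_closure_preimage mphi F.
have mw0 : measurable_fun [set: Z] w0.
  by apply/measurable_EFinP; exact: measurable_int iw0.
have fb_meas : measurable_fun [set: Z] (fun z => fine (beta z t)).
  by apply: measurableT_comp => //; exact: Bbeta.1.
have minner : measurable_fun [set: Z] (fun z => inner A (phi z)).
  rewrite /inner; apply: measurable_sum => i; exact: measurable_funM.
have mL : measurable_fun [set: Z] (L t).
  apply: measurable_funD; apply: measurable_funM => //; apply: measurable_funB => //.
  exact: Gg.1.
pose bphi k := \bigcap_(i : 'I_n) ((fun z => `|phi z ord0 i|) @^-1` `]-oo, k%:R]).
pose N (k j : nat) := phi @^-1` closure F `&` (L t @^-1` `]-oo, 0[ `&`
  (bphi k `&` (((fun z => `|fine (beta z t)|) @^-1` `]-oo, k%:R]) `&` E j))).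
have pre (f : Z -> R) (I : interval R) : measurable_fun [set: Z] f ->
    measurable (f @^-1` [set` I]).
  by move=> mf; rewrite -[X in measurable X]setTI; apply: mf => //; exact: measurable_itv.
have mN k j : measurable (N k j).
  apply: measurableI => //; apply: measurableI; first exact: pre.
  apply: measurableI.
    apply: fin_bigcap_measurable => // i _; apply: pre.
    exact: measurableT_comp.
  apply: measurableI; last exact: (Efin j).1.
  by apply: pre; exact: measurableT_comp.
have Nnull k j : {ae mu, forall z, ~ N k j z}.
  apply: (@pointwise_null t (N k j) k%:R) => //.
    apply: le_lt_trans (Efin j).2; apply: le_measure; rewrite ?inE//.
    - exact: (Efin j).1.
    - by move=> z [_ [_ [_ []]]].
  move=> z [cF [/= + [bz [/= + _]]]]; rewrite !in_itv/= => Lz bk; split=> // i.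
  by have := bz i I; rewrite /= in_itv.
have : {ae mu, forall z, forall k j, ~ N k j z}.
  by apply/ae_foralln => k; apply/ae_foralln => j; exact: Nnull.
apply: filterS => z Hz cF; rewrite leNgt; apply/negP => Lz.
have [j _ Ej] : (\bigcup_j E j) z by rewrite -ET.
pose b := \sum_(i < n) `|phi z ord0 i| + `|fine (beta z t)|.
have bk : b <= (Num.truncn b).+1%:R by apply/ltW/truncnS_gt.
apply: (Hz (Num.truncn b).+1 j); split=> //; split; first by rewrite /= in_itv.
split.
  move=> i _; rewrite /= in_itv/= (le_trans _ bk)// /b (bigD1 i)//= -addrA lerDl.
  by rewrite addr_ge0// sumr_ge0.
by split=> //; rewrite /= in_itv/= (le_trans _ bk)// lerDr sumr_ge0.
Qed.

End pointwise.
End dual_attainment.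

(** * From the separating functional to membership in the extension *)

Section dual_conclusion.
Context d (Z : measurableType d) (R : realType) (n : nat).
Variables (mu : {sigma_finite_measure set Z -> \bar R}) (phi : Z -> 'rV[R]_n).
Hypothesis mphi : forall i, measurable_fun [set: Z] (fun z => phi z ord0 i).
Variable beta : Z -> R -> \bar R.
Hypothesis Bbeta : class_B beta.
Variable a : 'rV[R]_n.
Hypothesis Jfin : J_ mu phi beta a \is a fin_num.

Lemma primal_subgradient (F : set 'rV[R]_n) (g : Z -> R) :
  face (cn mu phi) F -> F a ->
  (forall x, F x -> exists2 t : R, 0 < t & F (a - t *: x)) ->
  primal_solution mu phi beta a g ->
  (forall z, ~ closure F (phi z) -> g z = 0) ->
  exists th, {ae mu, forall z, closure F (phi z) ->
    subgradient (beta z) (inner th (phi z)) (g z)}.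
Proof.
move=> faceF Fa F_core pg g_supp.
have [[[Gg mg] g0] _] := pg.
have [A [tau [tau0 sep tauN0]]] :=
  competitor_separation Bbeta Jfin faceF Fa pg g_supp.
(* Restricting to rational [q] gives one exceptional null set for all [q] at once. *)
have pw : {ae mu, forall z, forall q : rat, 0 < q -> closure F (phi z) ->
    0 <= inner A (phi z) * (ratr q - g z) +
      tau * (fine (beta z (ratr q)) - fine (beta z (g z)))}.
  have : {ae mu, forall z, forall k, if unpickle k is Some q then 0 < q :> rat ->
    closure F (phi z) ->
    0 <= inner A (phi z) * (ratr q - g z) +
      tau * (fine (beta z (ratr q)) - fine (beta z (g z))) else True}.
    apply/ae_foralln => k; case: (unpickle k) => [q|]; last exact: aeW.
    have [q0|q0] := ltP 0 q; last exact: aeW.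
    have q0R : 0 < ratr q :> R by rewrite ltr0q.
    by apply: filterS (pointwise_inequality mphi Bbeta Jfin pg g_supp sep q0R) => z + _.
  by apply: filterS => z Hz q; have := Hz (pickle q); rewrite pickleK.
have [tauE|taupos] := eqVneq tau 0.
  exfalso; have [x Fx /negP] := tauN0 tauE; apply.
  (* For [tau = 0] the product of [inner A (phi z)] and [q - g z] is nonnegative: a rational [q]
     above [g z] gives the sign, one between 0 and [g z] the opposite sign. *)
  have c_sign : {ae mu, forall z, closure F (phi z) ->
      0 <= inner A (phi z) /\ (0 < g z -> inner A (phi z) = 0)}.
    apply: filterS pw => z Hz cF.
    have Hq (q : rat) : 0 < q -> 0 <= inner A (phi z) * (ratr q - g z).
      by move=> q0; have := Hz q q0 cF; rewrite tauE mul0r addr0.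
    have c0 : 0 <= inner A (phi z).
      have gz1 : g z < g z + 1 by lra.
      have [q] := rat_in_itvoo gz1; rewrite in_itv/= => /andP[gq _].
      have q0 : 0 < q by rewrite -(@ltr0q R); exact: le_lt_trans (g0 z) gq.
      by have := Hq q q0; rewrite pmulr_lge0// subr_gt0.
    split=> // gz; have [q] := rat_in_itvoo gz; rewrite in_itv/= => /andP[q0 qg].
    rewrite ltr0q in q0; have := Hq q q0; rewrite nmulr_lge0 ?subr_lt0// => cle.
    by apply/eqP; rewrite eq_le cle.
  have pos y : F y -> 0 <= inner A y.
    move=> Fy; have [_ _ /(_ y Fy) [h [Gh h0] hy] _] := faceF.
    rewrite -hy; have [ih <-] := inner_moment A Gh.
    have hv : {ae mu, forall z, ~ closure F (phi z) -> h z = 0}.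
      by apply: (face_vanish mphi faceF); [split|rewrite hy].
    rewrite fine_ge0//.
    rewrite (@ae_eq_integral _ _ _ mu setT (fun z => `|inner A (phi z) * h z|%:E))//.
    - exact: integral_ge0.
    - exact: measurable_int ih.
    - exact: measurable_int (integrable_norm ih).
    apply: filterS2 c_sign hv => z Hc hz _ /=.
    have [cF|nF] := pselect (closure F (phi z)).
      by rewrite ger0_norm// mulr_ge0//; have [] := Hc cF.
    by rewrite hz// mulr0 normr0.
  have Aa : inner A a = 0.
    rewrite -mg; have [ig <-] := inner_moment A Gg.
    rewrite /Rintegral (@ae_eq_integral _ _ _ mu setT (cst 0%E))//.
    - by rewrite integral0.
    - exact: measurable_int ig.
    apply: filterS c_sign => z Hc _ /=.
    have [cF|nF] := pselect (closure F (phi z)); last by rewrite g_supp// mulr0.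
    have := g0 z; rewrite le_eqVlt => /predU1P[<-|gz]; first by rewrite mulr0.
    by rewrite (Hc cF).2// mul0r.
  (* [A] is nonnegative on [F] and vanishes at [a]; applied to [a - t x] it is also nonpositive at
     [x], contradicting the choice of [x]. *)
  have [t t0 /pos] := F_core x Fx.
  rewrite innerBr Aa innerZr sub0r oppr_ge0 pmulr_rle0// => Ax.
  by rewrite eq_le Ax pos.
have tpos : 0 < tau by rewrite lt_neqAle eq_sym taupos.
(* Dividing the pointwise inequality by [tau] gives the subgradient inequality with this slope at
   positive rationals. *)
exists (- tau^-1 *: A).
have [ig _] := primal_integrable Bbeta Jfin pg.
have [_ bfin _] := integrable_fine_comp ig.
apply: filterS2 pw bfin => z Hz bz cF.
have gfin : beta z (g z) \is a fin_num by rewrite bz.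
apply: (subgradient_rat (Bbeta.2 z) gfin) => q q0.
have hq := Hz q q0 cF.
rewrite innerZl -(ler_pM2l tpos) mulrDr !mulrA mulrN mulfV// mulN1r; lra.
Qed.

(** On [closure F] the conjugate equals the slope times [g z] minus [beta z (g z)], a difference of
    integrable functions, so [K_ F th] is below [+oo]. *)
Lemma exn_of_subgradient (F : set 'rV[R]_n) (g : Z -> R) (th : 'rV[R]_n) :
  face (cn mu phi) F -> primal_solution mu phi beta a g ->
  (forall z, ~ closure F (phi z) -> g z = 0) ->
  {ae mu, forall z, closure F (phi z) ->
    subgradient (beta z) (inner th (phi z)) (g z)} ->
  exn mu phi beta (f_ phi beta F th) /\ g = f_ phi beta F th %[ae mu].
Proof.
move=> faceF pg g_supp sub; split; last first.
  apply: filterS sub => z sz _; rewrite /f_.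
  have [cF|nF] := pselect (closure F (phi z)); last first.
    by rewrite asboolF ?g_supp//; case=> /nF.
  have [ed edE] := conjugate_derive (Bbeta.2 z) (sz cF).
  by rewrite (asboolT (conj cF ed)) edE.
exists F => //; exists th => //; split; last first.
  by apply: filterS sub => z sz cF; apply: (conjugate_finite_near (Bbeta.2 z)); exact: sz.
have [ig _] := primal_integrable Bbeta Jfin pg.
have [ifg bfin _] := integrable_fine_comp ig.
have Gg : class_G mu phi g by case: pg => [[[]]].
have [ith _] := inner_moment th Gg.
have mS := measurable_closure_preimage mphi F.
have iw := integrableB measurableT ith ifg.
have iwS := integrableS measurableT mS (@subsetT _ _) iw.
have minner : measurable_fun [set: Z] (fun z => inner th (phi z)).
  by rewrite /inner; apply: measurable_sum => i; exact: measurable_funM.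
apply: (@le_lt_trans _ _ (\int[mu]_(z in phi @^-1` closure F)
    ((EFin \o (fun z => inner th (phi z) * g z)%R) z -
     (EFin \o (fine \o (fun z => beta z (g z)))) z))%E); last first.
  by have := integrable_fin_num mS iwS; rewrite fin_numElt => /andP[].
apply: pintegral_le => //.
  by apply: (measurable_conjugate Bbeta); exact: measurable_funTS.
apply: filterS sub => z sz cF.
by rewrite (conjugate_subgradient (Bbeta.2 z) (sz cF)).
Qed.

Lemma primal_exn (g : Z -> R) : primal_solution mu phi beta a g ->
  exists2 f, exn mu phi beta f & g = f %[ae mu].
Proof.
move=> pg; have [[[Gg mg] g0] _] := pg.
have coneC := cn_convex_cone mu phi.
have Ca : cn mu phi a by exists g.
pose F := minimal_face (cn mu phi) a.
have faceF : face (cn mu phi) F := minimal_face_face coneC Ca.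
have Fa : F a := minimal_face_self coneC Ca.
have F_core x : F x -> exists2 t : R, 0 < t & F (a - t *: x).
  exact: minimal_face_sub.
have mS := measurable_closure_preimage mphi F.
have gv : {ae mu, forall z, ~ closure F (phi z) -> g z = 0}.
  by apply: (face_vanish mphi faceF); [split|rewrite mg].
(* The separation argument needs a minimizer vanishing at every point off [closure F]; [g] does so
   only almost everywhere. *)
pose g1 z := g z * \1_(phi @^-1` closure F) z.
have g1g : g1 = g %[ae mu].
  apply: filterS gv => z gz _; rewrite /g1 indicE.
  have [|zF] := boolP (z \in _); first by rewrite mulr1.
  by rewrite mulr0 gz// => cF; rewrite mem_set in zF.
have mg1 : measurable_fun [set: Z] g1.
  by apply: measurable_funM; [exact: Gg.1|exact: measurable_indic].
have Gg1 : class_Gapos mu phi a g1.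
  by apply: (Gapos_ae mphi (conj Gg mg : class_Ga mu phi a g) mg1 g1g) => z; rewrite mulr_ge0.
have pg1 := primal_ae Bbeta Jfin pg Gg1 g1g.
have g1_supp z : ~ closure F (phi z) -> g1 z = 0.
  by move=> nF; rewrite /g1 indicE memNset// mulr0.
have [th sub] := primal_subgradient faceF Fa F_core pg1 g1_supp.
have [fE g1f] := exn_of_subgradient faceF pg1 g1_supp sub.
exists (f_ phi beta F th) => //.
by apply: filterS2 g1g g1f => z /(_ I) <- /(_ I) ->.
Qed.

End dual_conclusion.

Theorem corollary7p9 (d : measure_display) (Z : measurableType d)
    (R : realType) (n : nat)
    (mu : {sigma_finite_measure set Z -> \bar R})
    (phi : Z -> 'rV[R]_n)
    (mphi : forall i, measurable_fun [set: Z] (fun z => phi z ord0 i))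
    (beta : Z -> R -> \bar R) (Bbeta : class_B beta)
    (a : 'rV[R]_n) (Jfin : J_ mu phi beta a \is a fin_num) :
  (mod_ae mu (class_Ga mu phi a) `&` mod_ae mu (exn mu phi beta) !=set0 <->
     exists g_a, primal_solution mu phi beta a g_a) /\
  (forall g_a, primal_solution mu phi beta a g_a ->
     mod_ae mu (class_Ga mu phi a) `&` mod_ae mu (exn mu phi beta) =
     mod_ae mu [set g_a]).
Proof.
(* A common element of the two saturated sets makes a member of [class_Ga] and a member of [exn]
   equal almost everywhere. *)
have inter h : (mod_ae mu (class_Ga mu phi a) `&` mod_ae mu (exn mu phi beta)) h ->
    exists2 g, primal_solution mu phi beta a g & g = h %[ae mu].
  move=> [[g Gg hg] [f ef hf]].
  have gf : g = f %[ae mu].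
    by apply: filterS2 hg hf => z /(_ I) <- /(_ I) ->.
  have [g' pg' g'g] := exn_primal mphi Bbeta Jfin Gg ef gf.
  by exists g' => //; apply: filterS2 g'g hg => z /(_ I) -> /(_ I) ->.
have mem g : primal_solution mu phi beta a g ->
    (mod_ae mu (class_Ga mu phi a) `&` mod_ae mu (exn mu phi beta)) g.
  move=> pg; split; last exact: (primal_exn mphi Bbeta Jfin pg).
  by exists g; [exact: pg.1.1|apply: aeW => z _].
split.
  by split=> [[h /inter[g pg _]]|[g /mem]]; [exists g|exists g].
move=> g pg; apply/seteqP; split=> h.
  move=> /inter[g' pg' g'h]; exists g => //.
  have g'g := primal_unique Bbeta Jfin pg' pg.
  by apply: filterS2 g'h g'g => z /(_ I) <- /(_ I) ->.
move=> [_ -> hg]; have [[g1 G1 gg1] [f1 F1 gf1]] := mem g pg.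
split; [exists g1 => //|exists f1 => //].
  by apply: filterS2 hg gg1 => z /(_ I) -> /(_ I) ->.
by apply: filterS2 hg gf1 => z /(_ I) -> /(_ I) ->.
Qed.
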